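(* Let $A$ be a separable $C^*$-algebra. Then the following are equivalent: (1) $A$ is projective. (2) $A$ is semiprojective and weakly projective. (3) $A$ is semiprojective and contractible. (4) $A$ is semiprojective and has trivial shape.
   Context: A morphism between $C^*$-algebras is a $*$-homomorphism (not assumed unital); ideals are closed and two-sided. Two morphisms $\varphi_0,\varphi_1\colon A\to B$ are homotopic ($\varphi_0\simeq\varphi_1$) if there is a morphism $\Phi\colon A\to C([0,1],B)$ with $\mathrm{ev}_t\circ\Phi=\varphi_t$ for $t=0,1$. $A$ is contractible if $\mathrm{id}_A\simeq 0$. A $C^*$-algebra $A$ is projective if for every $C^*$-algebra $C$, ideal $J\lhd C$ and morphism $\sigma\colon A\to C/J$ there is a morphism $\psi\colon A\to C$ with $\pi\circ\psi=\sigma$, where $\pi\colon C\to C/J$ is the quotient morphism. $A$ is weakly projective if for all such $C,J,\sigma$ and every $\varepsilon>0$ and finite $F\subseteq A$ there is a morphism $\psi\colon A\to C$ with $\|\pi(\psi(x))-\sigma(x)\|<\varepsilon$ for all $x\in F$. A morphism $\varphi\colon A\to B$ is semiprojective if for every $C^*$-algebra $C$, increasing sequence of ideals $J_1\subseteq J_2\subseteq\cdots$ of $C$ and morphism $\sigma\colon B\to C/\overline{\bigcup_k J_k}$, there exist an index $k$ and a morphism $\psi\colon A\to C/J_k$ with $\pi_k\circ\psi=\sigma\circ\varphi$, where $\pi_k\colon C/J_k\to C/\overline{\bigcup_k J_k}$ is the quotient morphism. A $C^*$-algebra $A$ is semiprojective if $\mathrm{id}_A$ is. Inductive systems are sequential: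 $(A_k,\gamma_k)$ consists of $C^*$-algebras $A_1,A_2,\ldots$ and morphisms $\gamma_k\colon A_k\to A_{k+1}$, with $\gamma_{l,k}=\gamma_{l-1}\circ\cdots\circ\gamma_k$ for $k<l$. A shape system for a separable $C^*$-algebra $A$ is an inductive system $(A_k,\gamma_k)$ with $A\cong\varinjlim A_k$ and with all $\gamma_k$ semiprojective. Inductive systems $(A_k,\gamma_k)$ and $(B_n,\theta_n)$ are equivalent if there are indices $k_1<n_1<k_2<n_2<\cdots$ and morphisms $\alpha_i\colon A_{k_i}\to B_{n_i}$, $\beta_i\colon B_{n_i}\to A_{k_{i+1}}$ with $\beta_i\circ\alpha_i\simeq\gamma_{k_{i+1},k_i}$ and $\alpha_{i+1}\circ\beta_i\simeq\theta_{n_{i+1},n_i}$ for all $i$. Separable $C^*$-algebras $A,B$ are shape equivalent, $A\sim_{Sh}B$, if they have some shape systems that are equivalent. $A$ has trivial shape if $A\sim_{Sh}0$, where $0$ is the zero $C^*$-algebra. *)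

(* Defs.v *)
From HB Require Import structures.
From mathcomp Require Import all_boot all_order all_algebra.
From mathcomp Require Import complex.
From mathcomp Require Import all_classical all_reals all_analysis.

Set Implicit Arguments.
Unset Strict Implicit.
Unset Printing Implicit Defensive.

Import Order.TTheory GRing.Theory Num.Theory.
Import numFieldNormedType.Exports.

Local Open Scope classical_set_scope.
Local Open Scope ring_scope.
Local Open Scope complex_scope.

(* Complex C*-algebras, not assumed unital and possibly zero. In a
   [completeNormedModType R[i]] the norm takes values in [R[i]]; being
   nonnegative there, it is real. *)
HB.mixin Record isCStarAlgebra (R : realType) A
    & CompleteNormedModule R[i] A := {
  cmul : A -> A -> A ;
  cstar : A -> A ;
  cmulA : associative cmul ;
  cmulDl : left_distributive cmul +%R ;
  cmulDr : right_distributive cmul +%R ;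
  cscaleAl : forall (a : R[i]) (x y : A), a *: cmul x y = cmul (a *: x) y ;
  cscaleAr : forall (a : R[i]) (x y : A), a *: cmul x y = cmul x (a *: y) ;
  cstarK : involutive cstar ;
  cstarD : {morph cstar : x y / x + y} ;
  cstarZ : forall (a : R[i]) (x : A), cstar (a *: x) = a^*%R *: cstar x ;
  cstarM : forall x y, cstar (cmul x y) = cmul (cstar y) (cstar x) ;
  cnormM : forall x y : A, `|cmul x y| <= `|x| * `|y| ;
  cstar_identity : forall x : A, `|cmul (cstar x) x| = `|x| ^+ 2
}.

#[short(type="cstarAlgType")]
HB.structure Definition CStarAlgebra (R : realType) :=
  {A of isCStarAlgebra R A & CompleteNormedModule R[i] A}.

Section ZeroAlgebra.
Variable R : realType.

Definition zero_algebra (_ : realType) : Type := unit.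
Local Notation Z := (zero_algebra R).

HB.instance Definition _ := Choice.copy Z unit.

Let eqZ (x y : Z) : x = y.
Proof. by case: x y => [] []. Qed.

HB.instance Definition _ := GRing.isZmodule.Build Z
  (zero := tt) (opp := fun=> tt) (add := fun _ _ => tt)
  (fun _ _ _ => eqZ _ _) (fun _ _ => eqZ _ _)
  (fun _ => eqZ _ _) (fun _ => eqZ _ _).

HB.instance Definition _ := GRing.Zmodule_isLmodule.Build R[i] Z
  (scale := fun _ _ => tt)
  (fun _ _ _ => eqZ _ _) (fun _ => eqZ _ _)
  (fun _ _ _ => eqZ _ _) (fun _ _ _ => eqZ _ _).

Let znorm (_ : Z) : R[i] := 0.

Let znormD (x y : Z) : znorm (x + y) <= znorm x + znorm y.
Proof. by rewrite addr0. Qed.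

Let znormZ (a : R[i]) (x : Z) : znorm (a *: x) = `|a| * znorm x.
Proof. by rewrite mulr0. Qed.

HB.instance Definition _ := Lmodule_isNormed.Build R[i] Z
  znormD znormZ (fun _ _ => eqZ _ _).

Let zcomplete (F : set_system Z) : ProperFilter F -> cauchy F -> cvg F.
Proof.
move=> FF _; apply/cvg_ex; exists 0 => P /nbhs_singleton P0.
by apply: (filterS _ filterT) => x _; rewrite (eqZ x 0).
Qed.

HB.instance Definition _ := Uniform_isComplete.Build Z zcomplete.

Let znormM (x y : Z) : `|0 : Z| <= `|x| * `|y|.
Proof. by rewrite normr0 mulr_ge0. Qed.

Let zcstar (x : Z) : `|0 : Z| = `|x| ^+ 2.
Proof. by rewrite (eqZ x 0) normr0 expr0n. Qed.

HB.instance Definition _ := isCStarAlgebra.Build R Z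
  (cmul := fun _ _ => 0) (cstar := fun=> 0)
  (fun _ _ _ => eqZ _ _) (fun _ _ _ => eqZ _ _) (fun _ _ _ => eqZ _ _)
  (fun _ _ _ => eqZ _ _) (fun _ _ _ => eqZ _ _) (fun _ => eqZ _ _)
  (fun _ _ => eqZ _ _) (fun _ _ => eqZ _ _) (fun _ _ => eqZ _ _)
  znormM zcstar.

End ZeroAlgebra.

Definition separable_space (T : topologicalType) : Prop :=
  exists2 S : set T, countable S & dense S.

Section Morphisms.
Variable R : realType.
Implicit Types A B C : cstarAlgType R.

Definition cstar_morphism A B (f : A -> B) : Prop :=
  [/\ linear f,
      {morph f : x y / cmul x y} &
      {morph f : x / cstar x}].

(* A morphism from A to C([0,1],B), whose operations are pointwise, is a
   family of morphisms from A to B indexed by [0,1] whose value at each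
   element of A is continuous on [0,1]. *)
Definition homotopic A B (f0 f1 : A -> B) : Prop :=
  exists Phi : A -> R -> B,
    [/\ forall a, {within `[0%R, 1%R]%classic, continuous (Phi a)},
        forall t, t \in `[0%R, 1%R] -> cstar_morphism (Phi^~ t),
        forall a, Phi a 0 = f0 a &
        forall a, Phi a 1 = f1 a].

Definition contractible A : Prop :=
  homotopic (fun x : A => x) (fun _ : A => 0).

Definition closed_ideal C (J : set C) : Prop :=
  [/\ J 0,
      forall (a : R[i]) x y, J x -> J y -> J (a *: x + y),
      forall c x, J x -> J (cmul c x) /\ J (cmul x c) &
      closed J].

(* The quotient of C by J, up to isometric isomorphism: a C*-algebra with a
   surjective morphism from C whose kernel is J, carrying the quotient norm. *)
Record cstar_quotient C (J : set C) := CStarQuotient {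
  quotient_alg :> cstarAlgType R ;
  qproj : C -> quotient_alg ;
  qproj_morphism : cstar_morphism qproj ;
  qproj_surj : forall y, exists x, qproj x = y ;
  qproj_ker : forall x, qproj x = 0 <-> J x ;
  qproj_norm : forall x,
    complex.Re `|qproj x| = inf [set complex.Re `|x + j| | j in J]
}.

Definition projective A : Prop :=
  forall C (J : set C), closed_ideal J ->
  forall (Q : cstar_quotient J) (sigma : A -> Q), cstar_morphism sigma ->
  exists2 psi : A -> C, cstar_morphism psi &
    forall x, qproj Q (psi x) = sigma x.

Definition weakly_projective A : Prop :=
  forall C (J : set C), closed_ideal J ->
  forall (Q : cstar_quotient J) (sigma : A -> Q), cstar_morphism sigma ->
  forall (e : R) (F : set A), 0 < e -> finite_set F ->
  exists2 psi : A -> C, cstar_morphism psi &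
    forall x, F x -> `|qproj Q (psi x) - sigma x| < e%:C.

(* [pi k] is the quotient morphism from C/J_k to the quotient of C by the
   closed union, which is determined by its composite with C -> C/J_k. *)
Definition semiprojective_morphism A B (phi : A -> B) : Prop :=
  forall C (J : nat -> set C),
    (forall k, closed_ideal (J k)) ->
    (forall k, J k `<=` J k.+1) ->
  forall (Q : forall k, cstar_quotient (J k))
         (Qoo : cstar_quotient (closure (\bigcup_k J k)))
         (pi : forall k, Q k -> Qoo),
    (forall k x, pi k (qproj (Q k) x) = qproj Qoo x) ->
  forall sigma : B -> Qoo, cstar_morphism sigma ->
  exists k, exists2 psi : A -> Q k, cstar_morphism psi &
    forall x, pi k (psi x) = sigma (phi x).

Definition semiprojective A : Prop :=
  semiprojective_morphism (fun x : A => x).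

Record inductive_system := InductiveSystem {
  sys_alg :> nat -> cstarAlgType R ;
  sys_map : forall k, sys_alg k -> sys_alg k.+1 ;
  sys_map_morphism : forall k, cstar_morphism (@sys_map k)
}.

Fixpoint sys_iter (S : inductive_system) (k d : nat) : S k -> S (d + k)%N :=
  match d with
  | 0 => fun x => x
  | d'.+1 => fun x => sys_map (sys_iter d' x)
  end.

Definition connecting_map (S : inductive_system) (k l : nat) (kl : (k < l)%N)
    (x : S k) : S l :=
  ecast m (S m) (subnK (ltnW kl)) (sys_iter (l - k) x).

Definition cocone (S : inductive_system) B (f : forall k, S k -> B) : Prop :=
  (forall k, cstar_morphism (@f k)) /\
  (forall k x, f k.+1 (sys_map x) = f k x).

Definition is_inductive_limit (S : inductive_system) A : Prop :=
  exists2 iota : forall k, S k -> A, cocone iota &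
    forall B (f : forall k, S k -> B), cocone f ->
    exists! g : A -> B,
      cstar_morphism g /\ (forall k x, g (iota k x) = f k x).

Definition shape_system (S : inductive_system) A : Prop :=
  is_inductive_limit S A /\
  (forall k, semiprojective_morphism (@sys_map S k)).

Definition equivalent_systems (S T : inductive_system) : Prop :=
  exists (k n : nat -> nat)
         (kn : forall i, (k i < n i)%N) (nk : forall i, (n i < k i.+1)%N)
         (alpha : forall i, S (k i) -> T (n i))
         (beta : forall i, T (n i) -> S (k i.+1)),
    [/\ forall i, cstar_morphism (@alpha i),
        forall i, cstar_morphism (@beta i),
        forall i, homotopic (fun x => beta i (alpha i x))
                    (@connecting_map S _ _ (ltn_trans (kn i) (nk i))) &
        forall i, homotopic (fun x => alpha i.+1 (beta i x))
                    (@connecting_map T _ _ (ltn_trans (nk i) (kn i.+1)))].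

Definition shape_equivalent A B : Prop :=
  exists S T : inductive_system,
    [/\ shape_system S A, shape_system T B & equivalent_systems S T].

Definition trivial_shape A : Prop := shape_equivalent A (zero_algebra R).

End Morphisms.

(* Main.v *)
(* Idea. Everything rests on a stability property of a semiprojective A (lemma
   [liftable_of_cvg]): if morphisms g_n : A -> C/J have liftable approximants
   f_n with g_n - f_n -> 0 pointwise, then some g_n lifts to C. Indeed, perturbing
   the lifts of the f_n gives a morphism from A to the quotient of the bounded
   sequences in C by the null sequences in J, which is the closed union of the ideals
   J_k of the sequences in J that vanish from k on; a lift modulo J_k provides lifts
   of all g_n with n >= k.

   Stability yields (2) => (1) for separable A, and, by a supremum argument over
   [0,1], that liftability of morphisms A -> C/J is invariant under homotopy.
   A projective A is contractible, as its identity lifts to its cone.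

   For (4) => (1), let A be the limit of a system S equivalent to a system T with
   limit 0. By semiprojectivity, there are morphisms psi_n : A -> S_n whose images
   in A converge to the identity, so it suffices to lift the composite
   A -> S_n -> A -> C/J. It is homotopic to composites that factor through
   T_m -> T_l for l arbitrarily large; these tend to 0 pointwise as the limit of T
   is 0, hence one of them lifts.

   Morphisms are contractive, by an argument that only uses the C*-identity. *)
Require Import Defs.
From HB Require Import structures.
From mathcomp Require Import all_boot all_order all_algebra.
From mathcomp Require Import complex ring lra.
From mathcomp Require Import all_classical all_reals all_analysis.

Set Implicit Arguments.
Unset Strict Implicit.
Unset Printing Implicit Defensive.

Import Order.TTheory GRing.Theory Num.Theory.
Import numFieldNormedType.Exports.

Local Open Scope classical_set_scope.
Local Open Scope ring_scope.

(** * Real-valued norms and completeness *)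

Lemma Re_normK (R : realType) (a : R[i]) : (complex.Re `|a|)%:C%C = `|a|.
Proof. by rewrite RRe_real// normr_real. Qed.

Lemma Re_norm_ge0 (R : realType) (a : R[i]) : 0 <= complex.Re `|a|.
Proof. by rewrite -lecR Re_normK normr_ge0. Qed.

Lemma geometric_small (R : realType) (M q e : R) : 0 <= q < 1 -> 0 < e ->
  exists N, forall n, (N <= n)%N -> M * q ^+ n < e.
Proof.
move=> q01 e0.
have : (fun n => M * q ^+ n) @ \oo --> (0 : R).
  rewrite -[X in _ --> X](mulr0 M); apply: cvgMr.
  by apply: cvg_expr; rewrite ger0_norm; lra.
move=> /cvgrPdist_lt/(_ e e0)[N _ NP]; exists N => n Nn.
by have := NP n Nn; rewrite /= sub0r normrN; apply: le_lt_trans; exact: ler_norm.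
Qed.

Lemma geometric_le0 (R : realType) (x M q : R) : 0 <= q < 1 ->
  (forall n, x <= M * q ^+ n) -> x <= 0.
Proof.
move=> q01 xM; apply/ler_addgt0Pr => e e0; rewrite add0r.
have [N /(_ N (leqnn N))] := geometric_small M q01 e0.
by move=> /ltW; exact: le_trans.
Qed.

Section RealNorm.
Variables (R : realType) (V : normedModType R[i]).
Implicit Types (x y z : V) (e : R).

Definition nrm x : R := complex.Re `|x|.

Lemma nrmE x : `|x| = (nrm x)%:C%C.
Proof. by rewrite /nrm RRe_real// normr_real. Qed.

Lemma nrm_ge0 x : 0 <= nrm x.
Proof. by rewrite -lecR -nrmE normr_ge0. Qed.

Lemma nrm0 : nrm 0 = 0.
Proof. by rewrite /nrm normr0. Qed.

Lemma nrm0_eq0 x : nrm x = 0 -> x = 0.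
Proof. by move=> x0; apply: normr0_eq0; rewrite nrmE x0. Qed.

Lemma nrmN x : nrm (- x) = nrm x.
Proof. by rewrite /nrm normrN. Qed.

Lemma nrm_distrC x y : nrm (x - y) = nrm (y - x).
Proof. by rewrite /nrm distrC. Qed.

Lemma nrmD x y : nrm (x + y) <= nrm x + nrm y.
Proof. by rewrite -lecR rmorphD/= -!nrmE ler_normD. Qed.

Lemma nrmB x y : nrm (x - y) <= nrm x + nrm y.
Proof. by rewrite (le_trans (nrmD _ _))// nrmN. Qed.

Lemma nrm_triangle z x y : nrm (x - y) <= nrm (x - z) + nrm (z - y).
Proof. by rewrite (le_trans _ (nrmD _ _))// addrA subrK. Qed.

Lemma nrm_le_dist x y : nrm x <= nrm y + nrm (x - y).
Proof. by rewrite (le_trans _ (nrmD _ _))// addrC subrK. Qed.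

Lemma nrmZ (a : R[i]) x : nrm (a *: x) = complex.Re `|a| * nrm x.
Proof.
apply: complexI; rewrite rmorphM /= -!nrmE normrZ; congr (_ * _).
Qed.

Lemma nrmZr (t : R) x : nrm (t%:C%C *: x) = `|t| * nrm x.
Proof. by rewrite nrmZ normc_def/= expr0n/= addr0 sqrtr_sqr. Qed.

Lemma nbhs_nrmP x (P : set V) :
  nbhs x P <-> exists2 e : R, 0 < e & forall y, nrm (x - y) < e -> P y.
Proof.
split=> [/nbhs_normP[e /= e0 eP]|[e e0 eP]].
  have eE : e = (complex.Re e)%:C%C by rewrite RRe_real// gtr0_real.
  exists (complex.Re e); first by rewrite -ltcR -eE.
  by move=> y xy; apply: eP; rewrite /ball_ /= nrmE eE ltcR.
apply/nbhs_normP; exists (e%:C%C); first by rewrite /= ltcR.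
by move=> y; rewrite /ball_ /= nrmE ltcR; exact: eP.
Qed.

Lemma closure_nrmP (S : set V) x :
  closure S x <-> forall e, 0 < e -> exists2 y, S y & nrm (x - y) < e.
Proof.
split=> [Sx e e0|H P /nbhs_nrmP[e e0 eP]].
  have [|y [Sy]] := Sx [set y | nrm (x - y) < e]; last by exists y.
  by apply/nbhs_nrmP; exists e.
by have [y Sy xy] := H e e0; exists y; split=> //; exact: eP.
Qed.

Lemma closed_nrmP (S : set V) :
  closed S <-> forall x, (forall e, 0 < e -> exists2 y, S y & nrm (x - y) < e) -> S x.
Proof.
by split=> [cS x Hx|H x Sx]; [apply/cS/closure_nrmP|apply/H/closure_nrmP].
Qed.

(** Reduces completeness from filters to sequences, for the section algebras and the quotients built
    below. A Cauchy filter contains balls of radius 2^-n; two consecutive ones meet, so their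
    centers form a sequence with dyadic steps, and the filter converges to its limit. *)
Lemma cauchy_cvg_of_dyadic :
  (forall u : nat -> V, (forall n, nrm (u n.+1 - u n) < 2 * 2^-1 ^+ n) ->
    exists l (K : R), forall n, nrm (u n - l) <= K * 2^-1 ^+ n) ->
  forall F : set_system V, ProperFilter F -> cauchy F -> cvg F.
Proof.
move=> dyadic F FF /cauchyP cF.
have half : 0 <= (2^-1 : R) < 1 by lra.
have /choice[u uF] : forall n, exists x, F (ball x ((2^-1 : R) ^+ n)%:C%C).
  by move=> n; apply: cF; rewrite /= ltcR exprn_gt0.
have [n|l [K lu]] := dyadic u.
  have [z [/=]] := filter_ex (filterI (uF n) (uF n.+1)).
  rewrite -!ball_normE /ball_ /= !nrmE !ltcR => zn zn1.
  have := nrm_triangle z (u n.+1) (u n); rewrite (nrm_distrC z).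
  have := exprn_gt0 n (_ : 0 < (2^-1 : R)).
  by move: zn zn1; rewrite exprS; lra.
apply/cvg_ex; exists l => P /nbhs_nrmP[e e0 eP].
have [|N /(_ N (leqnn N)) Ne] := @geometric_small R (K + 1) 2^-1 e half.
  by lra.
apply: filterS (uF N) => z; rewrite -ball_normE /ball_ /= nrmE ltcR => uz.
apply: eP; have := nrm_triangle (u N) l z.
by have := lu N; rewrite (nrm_distrC l (u N)); lra.
Qed.

End RealNorm.

Lemma geometric_cvg (R : realType) (V : completeNormedModType R[i]) :
  forall (u : nat -> V) (M q : R), 0 <= q < 1 ->
  (forall n, nrm (u n.+1 - u n) <= M * q ^+ n) ->
  exists l, forall n, nrm (u n - l) <= M / (1 - q) * q ^+ n.
Proof.
move=> u M q q01 uM.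
have q1 : 0 < 1 - q by lra.
have M0 : 0 <= M by have := uM 0; rewrite expr0 mulr1; apply: le_trans; exact: nrm_ge0.
(* The bound is the exact partial sum of the geometric series, which lets the induction on d
   close. *)
have step n d : nrm (u (d + n)%N - u n) <= M / (1 - q) * (q ^+ n - q ^+ (d + n)).
  elim: d => [|d IH]; first by rewrite add0n !subrr nrm0 mulr0.
  rewrite addSn (le_trans (nrm_triangle (u (d + n)%N) _ _))//.
  have -> : M / (1 - q) * (q ^+ n - q ^+ (d + n).+1) =
    M * q ^+ (d + n) + M / (1 - q) * (q ^+ n - q ^+ (d + n)).
    by rewrite exprS; field; rewrite gt_eqF.
  exact: lerD.
have stepl n d : nrm (u (d + n)%N - u n) <= M / (1 - q) * q ^+ n.
  rewrite (le_trans (step n d))// ler_wpM2l ?divr_ge0 ?(ltW q1)//.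
  by rewrite lerBlDr lerDl exprn_ge0//; lra.
have : cauchy (u @ \oo).
  apply/cauchyP => e /= e0.
  have eE : e = (complex.Re e)%:C%C by rewrite RRe_real// gtr0_real.
  have [|N HN] := @geometric_small R (M / (1 - q)) q (complex.Re e) q01; first by rewrite -ltcR -eE.
  exists (u N); exists N => //= n /= Nn; rewrite -ball_normE /ball_ /= nrmE eE ltcR.
  rewrite nrm_distrC -(subnK Nn) (le_lt_trans (stepl _ _))//.
  exact: HN.
move=> /cauchy_cvg/cvg_ex[l ul]; exists l => n.
apply/ler_addgt0Pr => e e0.
have /ul[N _ /(_ (maxn N n) (leq_maxl _ _)) /= Hl] : nbhs l [set y | nrm (l - y) < e].
  by apply/nbhs_nrmP; exists e.
have := stepl n (maxn N n - n)%N; rewrite subnK ?leq_maxr// => Hs.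
have := nrm_triangle (u (maxn N n)) (u n) l.
by rewrite (nrm_distrC (u n) (u (maxn N n))) (nrm_distrC (u (maxn N n)) l); lra.
Qed.

(** * Morphisms are contractive *)

Section CStarNorm.
Variables (R : realType) (A : cstarAlgType R).
Implicit Types (x y z : A) (a : R[i]).

Lemma cmul0l x : cmul 0 x = 0.
Proof. by apply: (addIr (cmul 0 x)); rewrite -cmulDl addr0 add0r. Qed.

Lemma cmul0r x : cmul x 0 = 0.
Proof. by apply: (addIr (cmul x 0)); rewrite -cmulDr addr0 add0r. Qed.

Lemma cmulNl x y : cmul (- x) y = - cmul x y.
Proof. by rewrite -scaleN1r -cscaleAl scaleN1r. Qed.

Lemma cmulNr x y : cmul x (- y) = - cmul x y.
Proof. by rewrite -scaleN1r -cscaleAr scaleN1r. Qed.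

Lemma cmulBl x y z : cmul (x - y) z = cmul x z - cmul y z.
Proof. by rewrite cmulDl cmulNl. Qed.

Lemma cmulBr x y z : cmul x (y - z) = cmul x y - cmul x z.
Proof. by rewrite cmulDr cmulNr. Qed.

Lemma cstar0 : cstar 0 = 0 :> A.
Proof. by apply: (addIr (cstar 0)); rewrite -cstarD addr0 add0r. Qed.

Lemma cstarN x : cstar (- x) = - cstar x.
Proof. by rewrite -scaleN1r cstarZ rmorphN1 scaleN1r. Qed.

Lemma cstarZr (t : R) x : cstar (t%:C%C *: x) = t%:C%C *: cstar x.
Proof. by rewrite cstarZ conj_Creal// complex_real. Qed.

Lemma cstarB x y : cstar (x - y) = cstar x - cstar y.
Proof. by rewrite cstarD cstarN. Qed.

Lemma nrmM x y : nrm (cmul x y) <= nrm x * nrm y.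
Proof. by rewrite -lecR rmorphM/= -!nrmE cnormM. Qed.

Lemma nrm_cstar_mul x : nrm (cmul (cstar x) x) = nrm x ^+ 2.
Proof. by apply: complexI; rewrite rmorphXn/= -!nrmE cstar_identity. Qed.

Lemma nrm_cstar x : nrm (cstar x) = nrm x.
Proof.
suff le y : nrm y <= nrm (cstar y).
  by apply/le_anti; rewrite le andbT -[in leRHS](cstarK x) le.
have [->|y0] := eqVneq (nrm y) 0; first exact: nrm_ge0.
have /ler_pM2r <- : 0 < nrm y by rewrite lt_def y0 nrm_ge0.
by rewrite -expr2 -nrm_cstar_mul nrmM.
Qed.

End CStarNorm.

Section MorphismTheory.
Variable R : realType.
Implicit Types A B C : cstarAlgType R.

Lemma cstar_morphism_lin A B (f : A -> B) : cstar_morphism f ->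
  forall (a : R[i]) x y, f (a *: x + y) = a *: f x + f y.
Proof. by case. Qed.

Lemma cstar_morphismM A B (f : A -> B) : cstar_morphism f ->
  forall x y, f (cmul x y) = cmul (f x) (f y).
Proof. by case. Qed.

Lemma cstar_morphism_star A B (f : A -> B) : cstar_morphism f ->
  forall x, f (cstar x) = cstar (f x).
Proof. by case. Qed.

Lemma cstar_morphismD A B (f : A -> B) : cstar_morphism f -> {morph f : x y / x + y}.
Proof. by move=> fm x y; rewrite -[x]scale1r cstar_morphism_lin// !scale1r. Qed.

Lemma cstar_morphism0 A B (f : A -> B) : cstar_morphism f -> f 0 = 0.
Proof. by move=> fm; apply: (addIr (f 0)); rewrite -cstar_morphismD// addr0 add0r. Qed.

Lemma cstar_morphismZ A B (f : A -> B) : cstar_morphism f ->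
  forall (a : R[i]) x, f (a *: x) = a *: f x.
Proof.
by move=> fm a x; rewrite -[a *: x]addr0 cstar_morphism_lin// cstar_morphism0// addr0.
Qed.

Lemma cstar_morphismN A B (f : A -> B) : cstar_morphism f -> {morph f : x / - x}.
Proof. by move=> fm x; rewrite -scaleN1r cstar_morphismZ// scaleN1r. Qed.

Lemma cstar_morphismB A B (f : A -> B) : cstar_morphism f -> {morph f : x y / x - y}.
Proof. by move=> fm x y; rewrite cstar_morphismD// cstar_morphismN. Qed.

Lemma cstar_morphism_id A : cstar_morphism (fun x : A => x).
Proof. by []. Qed.

Lemma cstar_morphism_zero A B : cstar_morphism (fun _ : A => 0 : B).
Proof.
split=> [a x y|x y|x]; [by rewrite scaler0 addr0|by rewrite cmul0l|].
by rewrite cstar0.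
Qed.

Lemma cstar_morphism_comp A B C (f : A -> B) (g : B -> C) :
  cstar_morphism f -> cstar_morphism g -> cstar_morphism (fun x => g (f x)).
Proof.
by move=> [fl fM fs] [gl gM gs]; split=> [a x y|x y|x]; rewrite ?fl ?fM ?fs ?gl ?gM ?gs.
Qed.

(* For |h| < 1, the self-adjoint solution k of 2k = h^2 + k^2 is 1 - sqrt(1 - h^2),
   so that ih - k = u - 1 with u unitary in the unitization; it is obtained as a
   fixed point, so as to be mapped by any morphism to a solution of the same
   equation. *)
Lemma quasi_unitary_witness A (h : A) : cstar h = h -> nrm h < 1 ->
  exists k : A, [/\ cstar k = k, cmul h k = cmul k h &
                    k + k = cmul h h + cmul k k].
Proof.
move=> hs h1; pose r := nrm h.
have r0 : 0 <= r by exact: nrm_ge0.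
have r01 : 0 <= r < 1 by apply/andP.
have half0 (x : A) : nrm ((2^-1 : R)%:C%C *: x) = 2^-1 * nrm x.
  by rewrite nrmZr ger0_norm// invr_ge0 ler0n.
(* The fixed points of F are the solutions of 2k = h^2 + k^2; k is the limit of the iterates of F
   from 0. *)
pose F (k : A) := (2^-1 : R)%:C%C *: (cmul h h + cmul k k).
pose u n := iter n F (0 : A).
have us n : cstar (u n) = u n.
  elim: n => [|n IH] /=; first by rewrite cstar0.
  by rewrite /F cstarZr cstarD !cstarM IH hs.
have uh n : cmul h (u n) = cmul (u n) h.
  elim: n => [|n IH] /=; first by rewrite cmul0l cmul0r.
  rewrite /F -cscaleAr -cscaleAl; congr (_ *: _).
  by rewrite cmulDr cmulDl cmulA; congr (_ + _); rewrite cmulA IH -cmulA IH cmulA.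
have ur n : nrm (u n) <= r.
  elim: n => [|n IH] /=; first by rewrite nrm0.
  rewrite /F half0.
  have := nrmD (cmul h h) (cmul (u n) (u n)).
  have := nrmM h h; have := nrmM (u n) (u n); have := nrm_ge0 (u n).
  have : nrm (u n) * nrm (u n) <= r * r by rewrite ler_pM// nrm_ge0.
  have : r * r <= r by rewrite ler_piMl// ltW.
  rewrite -/r; lra.
(* On the ball of radius r, F contracts by the factor r: the difference of squares gives 2r, halved
   by the factor 1/2 in F. *)
have Fsub (k l : A) : nrm k <= r -> nrm l <= r -> nrm (F k - F l) <= r * nrm (k - l).
  move=> kr lr; rewrite /F -scalerBr half0 opprD addrACA subrr add0r.
  have -> : cmul k k - cmul l l = cmul k (k - l) + cmul (k - l) l.
    by rewrite cmulBr cmulBl addrA subrK.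
  have := nrmD (cmul k (k - l)) (cmul (k - l) l).
  have := nrmM k (k - l); have := nrmM (k - l) l.
  have : nrm k * nrm (k - l) <= r * nrm (k - l) by rewrite ler_wpM2r// nrm_ge0.
  have : nrm (k - l) * nrm l <= r * nrm (k - l) by rewrite mulrC ler_wpM2r// nrm_ge0.
  lra.
have [n|k uk] := @geometric_cvg R A u (nrm (u 1)) r r01.
  elim: n => [|n IH]; first by rewrite /u /= subr0 mulr1.
  apply: le_trans (Fsub (u n.+1) (u n) (ur _) (ur _)) _.
  by rewrite exprS mulrCA ler_wpM2l.
set M := nrm (u 1) / (1 - r) in uk.
have kr : nrm k <= r.
  rewrite -subr_le0; apply: (@geometric_le0 R _ M r) => // n.
  have := nrm_le_dist k (u n); have := uk n; have := ur n.
  by rewrite (nrm_distrC k); lra.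
(* A Lipschitz expression that vanishes at all iterates vanishes at their limit; this transfers
   self-adjointness and commutation with h to k. *)
have approx (f : A -> A) : (forall n, f (u n) = 0) ->
    (exists N, forall n, nrm (f (u n) - f k) <= N * nrm (u n - k)) -> f k = 0.
  move=> f0 [N Nf]; apply: nrm0_eq0; apply/le_anti; rewrite nrm_ge0 andbT.
  apply: (@geometric_le0 R _ (`|N| * M) r) => // n.
  have := Nf n; rewrite f0 sub0r nrmN => /le_trans; apply.
  rewrite (le_trans (ler_wpM2r (nrm_ge0 _) (ler_norm N)))//.
  by rewrite -mulrA; apply: ler_wpM2l (normr_ge0 _) _ _ (uk n).
have kF : F k = k.
  apply/eqP; rewrite -subr_eq0; apply/eqP/nrm0_eq0/le_anti; rewrite nrm_ge0 andbT.
  apply: (@geometric_le0 R _ (2 * r * M) r) => // n.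
  have := nrm_triangle (u n.+1) (F k) k; have := uk n.+1; rewrite exprS.
  have := Fsub k (u n) kr (ur n); rewrite -/(u n.+1) (nrm_distrC k).
  have := ler_wpM2l r0 (uk n).
  by rewrite [u n.+1]/=; lra.
exists k; split.
- apply/eqP; rewrite -subr_eq0; apply/eqP.
  apply: (approx (fun x => cstar x - x)) => [n|]; first by rewrite us subrr.
  exists 2 => n.
  have -> : cstar (u n) - u n - (cstar k - k) = cstar (u n - k) - (u n - k).
    by rewrite cstarB !opprD !opprK addrACA.
  by have := nrmB (cstar (u n - k)) (u n - k); rewrite nrm_cstar mulr_natl mulr2n.
- apply/eqP; rewrite -subr_eq0; apply/eqP.
  apply: (approx (fun x => cmul h x - cmul x h)) => [n|].
    by rewrite uh subrr.
  exists 2 => n.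
  have -> : cmul h (u n) - cmul (u n) h - (cmul h k - cmul k h) =
     cmul h (u n - k) - cmul (u n - k) h.
    by rewrite cmulBl cmulBr !opprD !opprK addrACA.
  have := nrmB (cmul h (u n - k)) (cmul (u n - k) h).
  have := nrmM h (u n - k); have := nrmM (u n - k) h.
  have : nrm h * nrm (u n - k) <= 1 * nrm (u n - k).
    by rewrite ler_wpM2r ?nrm_ge0 ?ltW.
  by rewrite [nrm (u n - k) * _]mulrC; lra.
- rewrite -{1 2}kF /F -scalerDl -rmorphD/=.
  have -> : 2^-1 + 2^-1 = 1 :> R by lra.
  by rewrite scale1r.
Qed.

(* With w = ih - k, the relation w + w^* + w^*w = 0 says that x |-> x + wx is
   isometric, by the C*-identity; the same holds for w^*, and 2ih = w - w^*. *)
Lemma quasi_unitary_bound A (h k : A) : cstar h = h -> cstar k = k ->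
  cmul h k = cmul k h -> k + k = cmul h h + cmul k k -> nrm h <= 1.
Proof.
move=> hs ks hk kE; pose i : R[i] := 'i%R.
have ii : i * i = -1 by rewrite -expr2 sqrCi.
pose w := i *: h - k; pose w' := - i *: h - k.
have ws : cstar w = w' by rewrite /w cstarB cstarZ ks hs conjCi.
have ws' : cstar w' = w by rewrite -ws cstarK.
have isom (v v' : A) : cstar v = v' -> v + v' + cmul v' v = 0 ->
    forall x, nrm (x + cmul v x) = nrm x.
  move=> vs vE x; apply/eqP; rewrite -(@eqrXn2 _ 2)// ?nrm_ge0// -!nrm_cstar_mul.
  rewrite cstarD cstarM vs cmulDl !cmulDr.
  have -> : cmul (cstar x) x + cmul (cstar x) (cmul v x) +
      (cmul (cmul (cstar x) v') x + cmul (cmul (cstar x) v') (cmul v x)) =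
      cmul (cstar x) x + cmul (cmul (cstar x) (v + v' + cmul v' v)) x.
    by rewrite !cmulDr !cmulDl !cmulA !addrA.
  by rewrite vE cmul0r cmul0l addr0.
(* Both a = i and a = -i are needed: the second instance is the relation for w', with the two
   elements exchanged. *)
have rel (a : R[i]) : a * a = -1 ->
    (a *: h - k) + (- a *: h - k) + cmul (- a *: h - k) (a *: h - k) = 0.
  move=> aa; rewrite cmulBl !cmulBr -!cscaleAl -!cscaleAr.
  rewrite scalerA mulNr aa opprK scale1r hk !scaleNr.
  rewrite [X in X + _]addrACA subrr add0r -opprD kE.
  by rewrite opprK [X in _ + (_ + X)]opprD opprK [X in _ + X]addrA addrK addNr.
have iso1 := isom w w' ws (rel i ii).
have iso2 : forall x, nrm (x + cmul w' x) = nrm x.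
  apply: (isom _ w ws'); rewrite addrC /w' /w; have := rel (- i).
  by rewrite mulrNN opprK => /(_ ii); rewrite addrC [X in X + cmul _ _]addrC.
(* Here 2i h^2 = (h + wh) - (h + w'h), and both terms have the norm of h; the C*-identity turns the
   left side into 2|h|^2. *)
have : 2 * nrm (cmul h h) <= 2 * nrm h.
  have -> : 2 * nrm (cmul h h) = nrm ((h + cmul w h) - (h + cmul w' h)).
    rewrite opprD addrACA subrr add0r -cmulBl /w /w' scaleNr opprD !opprK.
    rewrite addrACA addNr addr0 -scalerDl -cscaleAl nrmZ -mulr2n -[i *+ 2]mulr_natl normrM.
    by rewrite normCi mulr1 normr_nat -(rmorph_nat (real_complex R)).
  by rewrite (le_trans (nrmB _ _))// iso1 iso2 mulr_natl mulr2n.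
rewrite ler_pM2l// -{1}hs nrm_cstar_mul => h2.
have [->//|h0] := eqVneq (nrm h) 0.
by rewrite -(@ler_pM2r _ (nrm h)) ?lt_def ?h0 ?nrm_ge0// mul1r -expr2.
Qed.

(** A morphism maps a witness k for h to a witness for its image, which bounds the image of a
    self-adjoint h in the open unit ball by 1. Rescaling treats all self-adjoint elements, and the
    C*-identity reduces x to the self-adjoint x^* x. *)
Lemma cstar_morphism_contractive A B (f : A -> B) : cstar_morphism f ->
  forall x, nrm (f x) <= nrm x.
Proof.
move=> fm.
have unit_ball (h : A) : cstar h = h -> nrm h < 1 -> nrm (f h) <= 1.
  move=> hs h1; have [k [ks hk kE]] := quasi_unitary_witness hs h1.
  apply: (@quasi_unitary_bound B (f h) (f k)).
  - by rewrite -cstar_morphism_star// hs.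
  - by rewrite -cstar_morphism_star// ks.
  - by rewrite -!cstar_morphismM// hk.
  - by rewrite -!cstar_morphismM// -!cstar_morphismD// kE.
have selfadj (h : A) : cstar h = h -> nrm (f h) <= nrm h.
  move=> hs; apply/ler_addgt0Pr => e e0.
  have t0 : 0 < nrm h + e by have := nrm_ge0 h; lra.
  pose g := ((nrm h + e)^-1)%:C%C *: h.
  have := unit_ball g; rewrite /g (cstar_morphismZ fm) !nrmZr gtr0_norm ?invr_gt0//.
  rewrite cstarZr hs -ler_pdivlMl ?invr_gt0// invrK mulr1; apply => //.
  by rewrite mulrC ltr_pdivrMr// mul1r ltrDl.
move=> x; rewrite -(@ler_pXn2r _ 2)// ?nnegrE ?nrm_ge0//.
rewrite -!nrm_cstar_mul -cstar_morphism_star// -cstar_morphismM//.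
by apply: selfadj; rewrite cstarM cstarK.
Qed.

End MorphismTheory.

(** * Algebras of bounded sections *)

(** A common frame for two algebras with pointwise operations and supremum norm: bounded sequences
    ([product_space]) and the cone ([cone_space]). Closure under uniform limits is what makes the
    bounded sections complete. *)
Record section_space (R : realType) := SectionSpace {
  base : Type ;
  fiber : base -> cstarAlgType R ;
  section_pred : set (forall i, fiber i) ;
  section0 : section_pred (fun=> 0) ;
  section_lin : forall (a : R[i]) f g, section_pred f -> section_pred g ->
    section_pred (fun i => a *: f i + g i) ;
  section_mul : forall f g, section_pred f -> section_pred g ->
    section_pred (fun i => cmul (f i) (g i)) ;
  section_star : forall f, section_pred f -> section_pred (fun i => cstar (f i)) ;
  section_uniform : forall f,
    (forall e : R, 0 < e -> exists2 g, section_pred g & forall i, nrm (f i - g i) <= e) ->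
    section_pred f
}.

Record bsection (R : realType) (D : section_space R) := BSection {
  bsec :> forall i : base D, fiber i ;
  bsec_pred : section_pred bsec ;
  bsec_bounded : exists M : R, forall i, nrm (bsec i) <= M
}.

Section BoundedSections.
Variables (R : realType) (D : section_space R).
Local Notation E := (bsection D).
Implicit Types f g : E.

HB.instance Definition _ := gen_eqMixin E.
HB.instance Definition _ := gen_choiceMixin E.

Lemma bsecP f g : (forall i, f i = g i) -> f = g.
Proof.
case: f g => [f fp fb] [g gp gb] /= fg.
have fgE : f = g by exact: functional_extensionality_dep.
by move: fp fb; rewrite fgE => fp fb; congr BSection; exact: Prop_irrelevance.
Qed.

Fact bsec0_bounded : exists M : R, forall i : base D, nrm (0 : fiber i) <= M.
Proof. by exists 0 => i; rewrite nrm0. Qed.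

Fact bsec_lin_bounded (a : R[i]) f g :
  exists M : R, forall i, nrm (a *: f i + g i) <= M.
Proof.
have [[M Mf] [N Ng]] := (bsec_bounded f, bsec_bounded g).
exists (complex.Re `|a| * M + N) => i; rewrite (le_trans (nrmD _ _))// lerD// nrmZ.
by rewrite ler_wpM2l// Re_norm_ge0.
Qed.

Fact bsec_mul_bounded f g : exists M : R, forall i, nrm (cmul (f i) (g i)) <= M.
Proof.
have [[M Mf] [N Ng]] := (bsec_bounded f, bsec_bounded g).
by exists (M * N) => i; rewrite (le_trans (nrmM _ _))// ler_pM ?nrm_ge0.
Qed.

Fact bsec_star_bounded f : exists M : R, forall i, nrm (cstar (f i)) <= M.
Proof. by have [M Mf] := bsec_bounded f; exists M => i; rewrite nrm_cstar. Qed.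

Definition bsec0 : E := BSection (section0 D) bsec0_bounded.
Definition bsec_lin (a : R[i]) f g : E :=
  BSection (section_lin a (bsec_pred f) (bsec_pred g)) (bsec_lin_bounded a f g).
Definition bsec_mul f g : E :=
  BSection (section_mul (bsec_pred f) (bsec_pred g)) (bsec_mul_bounded f g).
Definition bsec_star f : E :=
  BSection (section_star (bsec_pred f)) (bsec_star_bounded f).

Definition bsec_add f g : E := bsec_lin 1 f g.
Definition bsec_scale a f : E := bsec_lin a f bsec0.
Definition bsec_opp f : E := bsec_scale (-1) f.

Fact bsec_addA : associative bsec_add.
Proof. by move=> f g h; apply: bsecP => i /=; rewrite !scale1r addrA. Qed.
Fact bsec_addC : commutative bsec_add.
Proof. by move=> f g; apply: bsecP => i /=; rewrite !scale1r addrC. Qed.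
Fact bsec_add0 : left_id bsec0 bsec_add.
Proof. by move=> f; apply: bsecP => i /=; rewrite scaler0 add0r. Qed.
Fact bsec_addN : left_inverse bsec0 bsec_opp bsec_add.
Proof. by move=> f; apply: bsecP => i /=; rewrite addr0 scaleN1r scale1r addNr. Qed.

HB.instance Definition _ :=
  GRing.isZmodule.Build E bsec_addA bsec_addC bsec_add0 bsec_addN.

Fact bsec_scaleA (a b : R[i]) f : bsec_scale a (bsec_scale b f) = bsec_scale (a * b) f.
Proof. by apply: bsecP => i /=; rewrite !addr0 scalerA. Qed.
Fact bsec_scale1 : left_id 1 bsec_scale.
Proof. by move=> f; apply: bsecP => i /=; rewrite addr0 scale1r. Qed.
Fact bsec_scaleDr : right_distributive bsec_scale +%R.
Proof. by move=> a f g; apply: bsecP => i /=; rewrite !addr0 !scale1r scalerDr. Qed.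
Fact bsec_scaleDl f : {morph bsec_scale^~ f : a b / a + b}.
Proof. by move=> a b; apply: bsecP => i /=; rewrite !addr0 !scale1r scalerDl. Qed.

HB.instance Definition _ := GRing.Zmodule_isLmodule.Build R[i] E
  bsec_scaleA bsec_scale1 bsec_scaleDr bsec_scaleDl.

Lemma bsecDE f g i : (f + g) i = f i + g i.
Proof. by rewrite [LHS]/= scale1r. Qed.
Lemma bsecZE (a : R[i]) f i : (a *: f) i = a *: f i.
Proof. by rewrite [LHS]/= addr0. Qed.
Lemma bsecBE f g i : (f - g) i = f i - g i.
Proof. by rewrite bsecDE; congr (_ + _); rewrite [LHS]/= addr0 scaleN1r. Qed.

Definition bnorm f : R := sup [set nrm (f i) | i in setT].

Lemma bnorm_ub f i : nrm (f i) <= bnorm f.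
Proof.
apply: ub_le_sup; last by exists i.
by have [M Mf] := bsec_bounded f; exists M => _ [j _ <-].
Qed.

Lemma bnorm_le f (M : R) : 0 <= M -> (forall i, nrm (f i) <= M) -> bnorm f <= M.
Proof.
move=> M0 fM; rewrite /bnorm.
(* Over an empty base the supremum is 0 by convention, whence the assumption that M is
   nonnegative. *)
have [->|/set0P ne] := eqVneq [set nrm (f i) | i in setT] set0; first by rewrite sup0.
by apply: ge_sup => // _ [i _ <-].
Qed.

Lemma bnorm_ge0 f : 0 <= bnorm f.
Proof.
rewrite /bnorm; have [->|/set0P[_ [i _ _]]] :=
  eqVneq [set nrm (f i) | i in setT] set0; first by rewrite sup0.
exact: le_trans (nrm_ge0 _) (bnorm_ub f i).
Qed.

Definition bsec_norm f : R[i] := (bnorm f)%:C%C.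

Fact bsec_normD f g : bsec_norm (f + g) <= bsec_norm f + bsec_norm g.
Proof.
rewrite -rmorphD lecR bnorm_le ?addr_ge0 ?bnorm_ge0// => i.
by rewrite bsecDE (le_trans (nrmD _ _))// lerD// bnorm_ub.
Qed.

Fact bsec_normZ (a : R[i]) f : bsec_norm (a *: f) = `|a| * bsec_norm f.
Proof.
(* One inequality for all scalars suffices: the reverse one for a nonzero a is the same inequality
   for its inverse. *)
have le (b : R[i]) g : bnorm (b *: g) <= complex.Re `|b| * bnorm g.
  apply: bnorm_le => [|i]; first by rewrite mulr_ge0 ?bnorm_ge0 ?Re_norm_ge0.
  by rewrite bsecZE nrmZ ler_wpM2l ?Re_norm_ge0// bnorm_ub.
rewrite /bsec_norm -[in RHS]Re_normK -rmorphM; congr (_ %:C%C).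
apply/le_anti; rewrite le andTb.
have [->|a0] := eqVneq a 0; first by rewrite normr0 mul0r bnorm_ge0.
rewrite -{1}[f]scale1r -(mulVf a0) -scalerA.
rewrite (le_trans (ler_wpM2l (Re_norm_ge0 a) (le _ _)))//.
rewrite mulrA -lecR !rmorphM/= !Re_normK -normrM mulfV// normr1 mul1r.
by rewrite lecR.
Qed.

Fact bsec_norm0_eq0 f : bsec_norm f = 0 -> f = 0.
Proof.
move=> [f0]; apply: bsecP => i; apply: nrm0_eq0; apply/le_anti.
by rewrite nrm_ge0 andbT -f0 bnorm_ub.
Qed.

HB.instance Definition _ :=
  Lmodule_isNormed.Build R[i] E bsec_normD bsec_normZ bsec_norm0_eq0.

Lemma nrm_bsec_ub f i : nrm (f i) <= nrm f.
Proof. exact: bnorm_ub. Qed.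

Lemma nrm_bsec_le f (M : R) : 0 <= M -> (forall i, nrm (f i) <= M) -> nrm f <= M.
Proof. exact: bnorm_le. Qed.

(** The limit is taken in each fiber; its rate of convergence does not depend on the point, so it is
    a uniform limit and hence again a bounded section. *)
Fact bsec_complete (F : set_system E) : ProperFilter F -> cauchy F -> cvg F.
Proof.
apply: cauchy_cvg_of_dyadic => u u2; pose q : R := 2^-1.
have q01 : 0 <= q < 1 by rewrite /q; lra.
have uiM i n : nrm (u n.+1 i - u n i) <= 2 * q ^+ n.
  by rewrite -bsecBE (le_trans (nrm_bsec_ub _ _))// ltW.
have lex i : exists l : fiber i, forall n, nrm (u n i - l) <= 2 / (1 - q) * q ^+ n.
  exact: geometric_cvg q01 (uiM i).
pose l i := sval (cid (lex i)).
have lu i : forall n, nrm (u n i - l i) <= 2 / (1 - q) * q ^+ n by exact: (svalP (cid (lex i))).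
have lpred : section_pred l.
  apply: section_uniform => e e0.
  have [N /(_ N (leqnn N)) Ne] := geometric_small (2 / (1 - q)) q01 e0.
  exists (u N) => [|i]; first exact: bsec_pred.
  by rewrite nrm_distrC (le_trans (lu i N))// ltW.
have lbnd : exists K : R, forall i, nrm (l i) <= K.
  exists (bnorm (u 0) + 2 / (1 - q)) => i.
  rewrite (le_trans (nrm_le_dist _ (u 0 i)))// lerD ?bnorm_ub// nrm_distrC.
  by rewrite (le_trans (lu i 0))// expr0 mulr1.
exists (BSection lpred lbnd), (2 / (1 - q)) => n.
apply: nrm_bsec_le => [|i]; last by rewrite bsecBE.
by rewrite mulr_ge0 ?exprn_ge0 ?divr_ge0//; lra.
Qed.

HB.instance Definition _ := Uniform_isComplete.Build E bsec_complete.

Fact bsec_mulA : associative bsec_mul.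
Proof. by move=> f g h; apply: bsecP => i /=; rewrite cmulA. Qed.
Fact bsec_mulDl : left_distributive bsec_mul +%R.
Proof. by move=> f g h; apply: bsecP => i; rewrite /= !scale1r cmulDl. Qed.
Fact bsec_mulDr : right_distributive bsec_mul +%R.
Proof. by move=> f g h; apply: bsecP => i; rewrite /= !scale1r cmulDr. Qed.
Fact bsec_scaleAl (a : R[i]) f g : a *: bsec_mul f g = bsec_mul (a *: f) g.
Proof. by apply: bsecP => i; rewrite /= !addr0 cscaleAl. Qed.
Fact bsec_scaleAr (a : R[i]) f g : a *: bsec_mul f g = bsec_mul f (a *: g).
Proof. by apply: bsecP => i; rewrite /= !addr0 cscaleAr. Qed.
Fact bsec_starK : involutive bsec_star.
Proof. by move=> f; apply: bsecP => i /=; rewrite cstarK. Qed.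
Fact bsec_starD : {morph bsec_star : f g / f + g}.
Proof. by move=> f g; apply: bsecP => i /=; rewrite !scale1r cstarD. Qed.
Fact bsec_starZ (a : R[i]) f : bsec_star (a *: f) = a^* *: bsec_star f.
Proof. by apply: bsecP => i /=; rewrite !addr0 cstarZ. Qed.
Fact bsec_starM f g : bsec_star (bsec_mul f g) = bsec_mul (bsec_star g) (bsec_star f).
Proof. by apply: bsecP => i /=; rewrite cstarM. Qed.
Fact bsec_normM f g : `|bsec_mul f g| <= `|f| * `|g|.
Proof.
rewrite !nrmE -rmorphM lecR nrm_bsec_le ?mulr_ge0 ?nrm_ge0// => i.
by rewrite (le_trans (nrmM _ _))// ler_pM ?nrm_ge0 ?nrm_bsec_ub.
Qed.
Fact bsec_cstar f : `|bsec_mul (bsec_star f) f| = `|f| ^+ 2.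
Proof.
rewrite !nrmE -rmorphXn; congr (_ %:C%C); apply/le_anti/andP; split.
  apply: nrm_bsec_le => [|i /=]; first by rewrite exprn_ge0// nrm_ge0.
  by rewrite nrm_cstar_mul lerXn2r ?nnegrE ?nrm_ge0// nrm_bsec_ub.
rewrite -ler_sqrt ?nrm_ge0// sqrtr_sqr ger0_norm ?nrm_ge0//.
apply: nrm_bsec_le => [|i]; first exact: sqrtr_ge0.
rewrite -[leLHS]ger0_norm ?nrm_ge0// -sqrtr_sqr ler_sqrt ?nrm_ge0//.
by rewrite -nrm_cstar_mul (nrm_bsec_ub (bsec_mul (bsec_star f) f) i).
Qed.

HB.instance Definition _ := isCStarAlgebra.Build R E
  bsec_mulA bsec_mulDl bsec_mulDr bsec_scaleAl bsec_scaleAr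
  bsec_starK bsec_starD bsec_starZ bsec_starM bsec_normM bsec_cstar.

Lemma bsec_eval_morphism i : cstar_morphism (fun f => f i).
Proof. by split=> // a f g; rewrite bsecDE bsecZE. Qed.

Lemma cstar_morphism_bsec (A : cstarAlgType R) (h : A -> E) :
  (forall i, cstar_morphism (fun x => h x i)) -> cstar_morphism h.
Proof.
move=> hm; split=> [a x y|x y|x]; apply: bsecP => i.
- by rewrite bsecDE bsecZE (cstar_morphism_lin (hm i)).
- by rewrite (cstar_morphismM (hm i)).
- by rewrite (cstar_morphism_star (hm i)).
Qed.

End BoundedSections.

(** * Quotients *)

Section Ideals.
Variables (R : realType) (C : cstarAlgType R).
Implicit Types (J : set C) (x y j : C).

Lemma closed_ideal0 J : closed_ideal J -> J 0.
Proof. by case. Qed.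

Lemma closed_idealZ J : closed_ideal J -> forall (a : R[i]) x, J x -> J (a *: x).
Proof. by move=> [J0 Jl _ _] a x Jx; rewrite -[a *: x]addr0; exact: Jl. Qed.

Lemma closed_idealD J : closed_ideal J -> forall x y, J x -> J y -> J (x + y).
Proof. by move=> [_ Jl _ _] x y Jx Jy; rewrite -[x]scale1r; exact: Jl. Qed.

Lemma closed_idealN J : closed_ideal J -> forall x, J x -> J (- x).
Proof. by move=> Jc x Jx; rewrite -scaleN1r; exact: closed_idealZ. Qed.

Lemma closed_idealB J : closed_ideal J -> forall x y, J x -> J y -> J (x - y).
Proof. by move=> Jc x y Jx Jy; apply: closed_idealD => //; exact: closed_idealN. Qed.

Lemma closed_ideal_mulr J : closed_ideal J -> forall c x, J x -> J (cmul c x).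
Proof. by move=> [_ _ Jm _] c x /(Jm c)[]. Qed.

Lemma closed_ideal_mull J : closed_ideal J -> forall c x, J x -> J (cmul x c).
Proof. by move=> [_ _ Jm _] c x /(Jm c)[]. Qed.

Lemma closed_ideal_nrm J : closed_ideal J -> forall x,
  (forall e : R, 0 < e -> exists2 y, J y & nrm (x - y) < e) -> J x.
Proof. by move=> [_ _ _ Jc]; apply/closed_nrmP. Qed.

(* The last two conditions hold for every closed ideal, but their general proof
   rests on functional calculus; the last one gives the C*-identity in the quotient. *)
Definition cstar_ideal J : Prop :=
  [/\ closed_ideal J, forall x, J x -> J (cstar x) &
      forall x j (e : R), J j -> 0 < e -> exists2 j', J j' &
        nrm (x + j') ^+ 2 <= nrm (cmul (cstar x) x + j) + e].

Lemma cstar_ideal_closed J : cstar_ideal J -> closed_ideal J.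
Proof. by case. Qed.

Lemma cstar_idealT : cstar_ideal (@setT C).
Proof.
split; [|by []|].
  by split; [| | |exact: closedT].
move=> x j e _ e0; exists (- x) => //.
by rewrite subrr nrm0 expr0n/= addr_ge0 ?nrm_ge0// ltW.
Qed.

Definition quotient_norm J x : R := inf [set nrm (x + j) | j in J].

Lemma quotient_norm_le J x j : J j -> quotient_norm J x <= nrm (x + j).
Proof.
move=> Jj; apply: ge_inf; last by exists j.
by exists 0 => _ [k _ <-]; exact: nrm_ge0.
Qed.

Lemma quotient_norm_le_nrm J x : closed_ideal J -> quotient_norm J x <= nrm x.
Proof.
by move=> /closed_ideal0 J0; rewrite -{2}[x]addr0; exact: quotient_norm_le.
Qed.

Lemma le_quotient_norm J x (m : R) : closed_ideal J ->
  (forall j, J j -> m <= nrm (x + j)) -> m <= quotient_norm J x.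
Proof.
move=> Jc mJ; apply: lb_le_inf => [|_ [j Jj <-]]; last exact: mJ.
by exists (nrm (x + 0)); exists 0 => //; exact: closed_ideal0.
Qed.

Lemma quotient_norm_lt J x (m : R) : closed_ideal J -> quotient_norm J x < m ->
  exists2 j, J j & nrm (x + j) < m.
Proof.
move=> Jc; rewrite /quotient_norm => /inf_lt[|_ [j Jj <-]]; last by exists j.
by exists (nrm (x + 0)); exists 0 => //; exact: closed_ideal0.
Qed.

End Ideals.

(** A coset is stored as a subset of C, so that congruent elements give equal cosets by
    extensionality. The proof [Jg] is a parameter of the type because the C*-structure put on it
    depends on that proof. *)
Record coset (R : realType) (C : cstarAlgType R) (J : set C) (Jg : cstar_ideal J) :=
  Coset { cset : set C ; csetP : exists x, cset = [set y | J (y - x)] }.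

Section Quotient.
Variables (R : realType) (C : cstarAlgType R) (J : set C) (Jg : cstar_ideal J).
Local Notation Q := (coset Jg).
Local Notation qn := (quotient_norm J).
Let Jc := cstar_ideal_closed Jg.
Implicit Types (x y z : C) (p q r : Q).

HB.instance Definition _ := gen_eqMixin Q.
HB.instance Definition _ := gen_choiceMixin Q.

Definition coset_of x : Q := @Coset R C J Jg [set y | J (y - x)] (ex_intro _ x erefl).
Definition coset_repr q : C := sval (cid (csetP q)).

Lemma coset_ofK q : coset_of (coset_repr q) = q.
Proof.
case: q => s sP; rewrite /coset_of /coset_repr; case: cid => x /= sE.
move: (ex_intro _ _ _) => P; move: sP P; rewrite sE => sP P.
by congr Coset; exact: Prop_irrelevance.
Qed.

Lemma coset_ofP x y : coset_of x = coset_of y <-> J (x - y).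
Proof.
split=> [[/(congr1 (@^~ x))/=]|Jxy].
  by rewrite subrr => <-; exact: closed_ideal0.
have E : [set z | J (z - x)] = [set z | J (z - y)].
  apply/seteqP; split=> z /= Jz.
    by rewrite -[z](subrK x) -addrA; exact: closed_idealD.
  by rewrite -[z](subrK y) -addrA -(opprB x y); exact: closed_idealB.
rewrite /coset_of; move: (ex_intro _ _ _) => P; move: (ex_intro _ _ _) P.
by rewrite E => P P'; congr Coset; exact: Prop_irrelevance.
Qed.

Lemma coset_reprK x : J (coset_repr (coset_of x) - x).
Proof. by apply/coset_ofP; exact: coset_ofK. Qed.

Lemma coset_ind (P : Q -> Prop) : (forall x, P (coset_of x)) -> forall q, P q.
Proof. by move=> Px q; rewrite -(coset_ofK q). Qed.

Definition coset_lin (a : R[i]) p q : Q := coset_of (a *: coset_repr p + coset_repr q).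
Definition coset_mul p q : Q := coset_of (cmul (coset_repr p) (coset_repr q)).
Definition coset_star p : Q := coset_of (cstar (coset_repr p)).

Lemma coset_linE (a : R[i]) x y :
  coset_lin a (coset_of x) (coset_of y) = coset_of (a *: x + y).
Proof.
apply/coset_ofP; rewrite opprD addrACA -scalerBr; apply: closed_idealD => //.
  by apply: closed_idealZ => //; exact: coset_reprK.
exact: coset_reprK.
Qed.

Lemma coset_mulE x y : coset_mul (coset_of x) (coset_of y) = coset_of (cmul x y).
Proof.
apply/coset_ofP; set x' := coset_repr _; set y' := coset_repr _.
have -> : cmul x' y' - cmul x y = cmul x' (y' - y) + cmul (x' - x) y.
  by rewrite cmulBr cmulBl addrA subrK.
apply: closed_idealD => //.
  by apply: closed_ideal_mulr => //; exact: coset_reprK.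
by apply: closed_ideal_mull => //; exact: coset_reprK.
Qed.

Lemma coset_starE x : coset_star (coset_of x) = coset_of (cstar x).
Proof. by apply/coset_ofP; rewrite -cstarB; case: Jg => _ + _; apply; exact: coset_reprK. Qed.

Definition coset_add p q : Q := coset_lin 1 p q.
Definition coset_scale a p : Q := coset_lin a p (coset_of 0).
Definition coset_opp p : Q := coset_scale (-1) p.

Lemma coset_addE x y : coset_add (coset_of x) (coset_of y) = coset_of (x + y).
Proof. by rewrite /coset_add coset_linE scale1r. Qed.
Lemma coset_scaleE (a : R[i]) x : coset_scale a (coset_of x) = coset_of (a *: x).
Proof. by rewrite /coset_scale coset_linE addr0. Qed.

Fact coset_addA : associative coset_add.
Proof.
by elim/coset_ind=> x; elim/coset_ind=> y; elim/coset_ind=> z; rewrite !coset_addE addrA.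
Qed.
Fact coset_addC : commutative coset_add.
Proof. by elim/coset_ind=> x; elim/coset_ind=> y; rewrite !coset_addE addrC. Qed.
Fact coset_add0 : left_id (coset_of 0) coset_add.
Proof. by elim/coset_ind=> x; rewrite coset_addE add0r. Qed.
Fact coset_addN : left_inverse (coset_of 0) coset_opp coset_add.
Proof.
by elim/coset_ind=> x; rewrite /coset_opp coset_scaleE coset_addE scaleN1r addNr.
Qed.

HB.instance Definition _ :=
  GRing.isZmodule.Build Q coset_addA coset_addC coset_add0 coset_addN.

Lemma coset_ofD x y : coset_of x + coset_of y = coset_of (x + y).
Proof. exact: coset_addE. Qed.

Fact coset_scaleA (a b : R[i]) q :
  coset_scale a (coset_scale b q) = coset_scale (a * b) q.
Proof. by elim/coset_ind: q => x; rewrite !coset_scaleE scalerA. Qed.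
Fact coset_scale1 : left_id 1 coset_scale.
Proof. by elim/coset_ind=> x; rewrite coset_scaleE scale1r. Qed.
Fact coset_scaleDr : right_distributive coset_scale +%R.
Proof.
move=> a; elim/coset_ind=> x; elim/coset_ind=> y.
by rewrite coset_ofD !coset_scaleE coset_ofD scalerDr.
Qed.
Fact coset_scaleDl q : {morph coset_scale^~ q : a b / a + b}.
Proof.
by move=> a b; elim/coset_ind: q => x; rewrite !coset_scaleE coset_ofD scalerDl.
Qed.

HB.instance Definition _ := GRing.Zmodule_isLmodule.Build R[i] Q
  coset_scaleA coset_scale1 coset_scaleDr coset_scaleDl.

Lemma coset_ofZ (a : R[i]) x : a *: coset_of x = coset_of (a *: x).
Proof. exact: coset_scaleE. Qed.

Lemma coset_ofB x y : coset_of x - coset_of y = coset_of (x - y).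
Proof. by rewrite -scaleN1r coset_ofZ coset_ofD scaleN1r. Qed.

Lemma quotient_norm_ge0 x : 0 <= qn x.
Proof. by apply: le_quotient_norm => // j _; exact: nrm_ge0. Qed.

Lemma quotient_normDr x j : J j -> qn (x + j) = qn x.
Proof.
move=> Jj; apply/le_anti/andP; split; apply: le_quotient_norm => // k Jk.
  have -> : x + k = x + j + (k - j) by rewrite addrACA subrr addr0.
  by apply: quotient_norm_le; exact: closed_idealB.
by rewrite -addrA; apply: quotient_norm_le; exact: closed_idealD.
Qed.

Lemma quotient_normD x y : qn (x + y) <= qn x + qn y.
Proof.
rewrite -lerBlDr; apply: le_quotient_norm => // j Jj.
rewrite lerBlDr -lerBlDl; apply: le_quotient_norm => // k Jk.
rewrite lerBlDl (le_trans _ (nrmD _ _))// addrACA.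
by apply: quotient_norm_le; exact: closed_idealD.
Qed.

Lemma quotient_normZ (a : R[i]) x : qn (a *: x) = complex.Re `|a| * qn x.
Proof.
have le (b : R[i]) y : complex.Re `|b| * qn y <= qn (b *: y).
  have [->|b0] := eqVneq b 0; first by rewrite normr0 mul0r quotient_norm_ge0.
  apply: le_quotient_norm => // j Jj.
  rewrite -[j]scale1r -(mulfV b0) -scalerA -scalerDr nrmZ ler_wpM2l ?Re_norm_ge0//.
  by apply: quotient_norm_le; exact: closed_idealZ.
apply/le_anti; rewrite le andbT.
have [->|a0] := eqVneq a 0.
  by rewrite scale0r normr0 mul0r (le_trans (quotient_norm_le_nrm _ Jc))// nrm0.
have := ler_wpM2l (Re_norm_ge0 a) (le (a^-1) (a *: x)).
rewrite scalerA mulVf// scale1r mulrA.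
suff -> : complex.Re `|a| * complex.Re `|a^-1| = 1 by rewrite mul1r.
by apply: complexI; rewrite rmorphM /= !Re_normK -normrM mulfV// normr1.
Qed.

Lemma quotient_norm_eq0 x : qn x = 0 -> J x.
Proof.
move=> x0; apply: (closed_ideal_nrm Jc) => e e0.
have [|j Jj xj] := @quotient_norm_lt _ _ J x e Jc; first by rewrite x0.
by exists (- j); [exact: closed_idealN|rewrite opprK].
Qed.

Lemma quotient_normM x y : qn (cmul x y) <= qn x * qn y.
Proof.
have key j k : J j -> J k -> qn (cmul x y) <= nrm (x + j) * nrm (y + k).
  move=> Jj Jk; apply: le_trans (nrmM _ _).
  rewrite cmulDr !cmulDl -!addrA; apply: quotient_norm_le.
  by do !apply: closed_idealD => //; [apply: closed_ideal_mull|
    apply: closed_ideal_mulr|apply: closed_ideal_mulr].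
(* The infimum is taken over one factor at a time; each passage divides by the other factor, so its
   vanishing is a separate case. *)
have key' j : J j -> qn (cmul x y) <= nrm (x + j) * qn y.
  move=> Jj; have := nrm_ge0 (x + j); rewrite le_eqVlt => /orP[/eqP n0|n0].
    by have := key j 0 Jj (closed_ideal0 Jc); rewrite -n0 !mul0r.
  rewrite -ler_pdivrMl//; apply: le_quotient_norm => // k Jk.
  by rewrite ler_pdivrMl//; exact: key.
have := quotient_norm_ge0 y; rewrite le_eqVlt => /orP[/eqP n0|n0].
  by have := key' 0 (closed_ideal0 Jc); rewrite -n0 !mulr0.
rewrite -ler_pdivrMr//; apply: le_quotient_norm => // j Jj.
by rewrite ler_pdivrMr//; exact: key'.
Qed.

Lemma quotient_norm_star x : qn (cstar x) <= qn x.
Proof.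
apply: le_quotient_norm => // j Jj; rewrite -nrm_cstar cstarD.
by apply: quotient_norm_le; case: Jg => _ + _; exact.
Qed.

(** The inequality from right to left is the last condition of [cstar_ideal], with e tending to
    0. *)
Lemma quotient_norm_cstar x : qn (cmul (cstar x) x) = qn x ^+ 2.
Proof.
apply/le_anti/andP; split.
  by rewrite (le_trans (quotient_normM _ _))// expr2 ler_wpM2r ?quotient_norm_ge0//
    quotient_norm_star.
apply: le_quotient_norm => // j Jj; apply/ler_addgt0Pr => e e0.
have [_ _ /(_ x j e Jj e0)[k Jk]] := Jg; apply: le_trans.
by rewrite lerXn2r ?nnegrE ?quotient_norm_ge0 ?nrm_ge0// quotient_norm_le.
Qed.

Definition coset_norm q : R[i] := (qn (coset_repr q))%:C%C.

Lemma coset_normE x : coset_norm (coset_of x) = (qn x)%:C%C.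
Proof.
by rewrite /coset_norm -[coset_repr _](subrK x) addrC quotient_normDr//; exact: coset_reprK.
Qed.

Fact coset_normD p q : coset_norm (p + q) <= coset_norm p + coset_norm q.
Proof.
elim/coset_ind: p => x; elim/coset_ind: q => y; rewrite coset_ofD !coset_normE.
by rewrite -rmorphD lecR quotient_normD.
Qed.

Fact coset_normZ (a : R[i]) q : coset_norm (a *: q) = `|a| * coset_norm q.
Proof.
elim/coset_ind: q => x.
by rewrite coset_ofZ !coset_normE quotient_normZ -[in RHS]Re_normK -rmorphM.
Qed.

Fact coset_norm_eq0 q : coset_norm q = 0 -> q = 0.
Proof.
elim/coset_ind: q => x; rewrite coset_normE => -[x0]; apply/coset_ofP.
by rewrite subr0; exact: quotient_norm_eq0.
Qed.

HB.instance Definition _ :=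
  Lmodule_isNormed.Build R[i] Q coset_normD coset_normZ coset_norm_eq0.

Lemma nrm_coset x : nrm (coset_of x) = qn x.
Proof. by rewrite /nrm [`|_|](coset_normE x). Qed.

Fact coset_complete (F : set_system Q) : ProperFilter F -> cauchy F -> cvg F.
Proof.
apply: cauchy_cvg_of_dyadic => u u2.
(* A representative of u n extends to one of u n.+1 at a distance below the dyadic step. The
   resulting representatives converge in C, and the class of their limit is the limit of u. *)
have lift n x : coset_of x = u n ->
    exists2 y, coset_of y = u n.+1 & nrm (y - x) < 2 * 2^-1 ^+ n.
  move=> xu; have := u2 n; elim/coset_ind: (u n.+1) => y.
  rewrite -xu coset_ofB nrm_coset => /(quotient_norm_lt Jc)[j Jj jn].
  exists (y + j); last by rewrite addrAC.
  by apply/coset_ofP; rewrite addrC addKr.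
pose P n x := [set y | coset_of y = u n.+1 /\ nrm (y - x) < 2 * 2^-1 ^+ n].
(* The default 0 of [xget] is never taken: by [lift], each set P m (w m) is inhabited. *)
pose w := fix w n := if n is m.+1 then xget 0 (P m (w m)) else coset_repr (u 0).
have wP n : coset_of (w n) = u n -> P n (w n) (w n.+1).
  by move=> /lift[y yu yx]; apply: xgetPex; exists y.
have wu n : coset_of (w n) = u n.
  by elim: n => [|n /wP[]//]; exact: coset_ofK.
have half : 0 <= (2^-1 : R) < 1 by lra.
have [n|l wl] := geometric_cvg half (_ : forall n, nrm (w n.+1 - w n) <= 2 * 2^-1 ^+ n).
  by have [_ /ltW] := wP n (wu n).
exists (coset_of l), (2 / (1 - 2^-1)) => n.
rewrite -wu coset_ofB nrm_coset (le_trans _ (wl n))//.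
exact: quotient_norm_le_nrm.
Qed.

HB.instance Definition _ := Uniform_isComplete.Build Q coset_complete.

Fact coset_mulA : associative coset_mul.
Proof.
by elim/coset_ind=> x; elim/coset_ind=> y; elim/coset_ind=> z; rewrite !coset_mulE cmulA.
Qed.
Fact coset_mulDl : left_distributive coset_mul +%R.
Proof.
elim/coset_ind=> x; elim/coset_ind=> y; elim/coset_ind=> z.
by rewrite coset_ofD !coset_mulE coset_ofD cmulDl.
Qed.
Fact coset_mulDr : right_distributive coset_mul +%R.
Proof.
elim/coset_ind=> x; elim/coset_ind=> y; elim/coset_ind=> z.
by rewrite coset_ofD !coset_mulE coset_ofD cmulDr.
Qed.
Fact coset_scaleAl (a : R[i]) p q : a *: coset_mul p q = coset_mul (a *: p) q.
Proof.
elim/coset_ind: p => x; elim/coset_ind: q => y.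
by rewrite coset_ofZ !coset_mulE coset_ofZ cscaleAl.
Qed.
Fact coset_scaleAr (a : R[i]) p q : a *: coset_mul p q = coset_mul p (a *: q).
Proof.
elim/coset_ind: p => x; elim/coset_ind: q => y.
by rewrite coset_ofZ !coset_mulE coset_ofZ cscaleAr.
Qed.
Fact coset_starK : involutive coset_star.
Proof. by elim/coset_ind=> x; rewrite !coset_starE cstarK. Qed.
Fact coset_starD : {morph coset_star : p q / p + q}.
Proof.
elim/coset_ind=> x; elim/coset_ind=> y.
by rewrite coset_ofD !coset_starE coset_ofD cstarD.
Qed.
Fact coset_starZ (a : R[i]) q : coset_star (a *: q) = a^* *: coset_star q.
Proof. by elim/coset_ind: q => x; rewrite coset_ofZ !coset_starE coset_ofZ cstarZ. Qed.
Fact coset_starM p q : coset_star (coset_mul p q) = coset_mul (coset_star q) (coset_star p).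
Proof.
elim/coset_ind: p => x; elim/coset_ind: q => y.
by rewrite coset_mulE !coset_starE coset_mulE cstarM.
Qed.
Fact coset_normM p q : `|coset_mul p q| <= `|p| * `|q|.
Proof.
elim/coset_ind: p => x; elim/coset_ind: q => y.
by rewrite coset_mulE !nrmE -rmorphM lecR !nrm_coset quotient_normM.
Qed.
Fact coset_cstar q : `|coset_mul (coset_star q) q| = `|q| ^+ 2.
Proof.
elim/coset_ind: q => x.
by rewrite coset_starE coset_mulE !nrmE -rmorphXn !nrm_coset quotient_norm_cstar.
Qed.

HB.instance Definition _ := isCStarAlgebra.Build R Q
  coset_mulA coset_mulDl coset_mulDr coset_scaleAl coset_scaleAr
  coset_starK coset_starD coset_starZ coset_starM coset_normM coset_cstar.

Lemma coset_of_morphism : cstar_morphism (coset_of : C -> Q).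
Proof.
split=> [a x y|x y|x]; first by rewrite coset_ofZ coset_ofD.
- by rewrite [RHS]coset_mulE.
- by rewrite [RHS]coset_starE.
Qed.

(** Composing f with the choice of representatives gives the map induced by f on the quotient. *)
Lemma coset_factorE (D : cstarAlgType R) (f : C -> D) : cstar_morphism f ->
  (forall x, J x -> f x = 0) -> forall x, f (coset_repr (coset_of x)) = f x.
Proof.
move=> fm fJ x; apply/eqP; rewrite -subr_eq0 -(cstar_morphismB fm); apply/eqP/fJ.
exact: coset_reprK.
Qed.

Lemma coset_factor_morphism (D : cstarAlgType R) (f : C -> D) : cstar_morphism f ->
  (forall x, J x -> f x = 0) -> cstar_morphism (fun q : Q => f (coset_repr q)).
Proof.
move=> fm fJ; have fE := coset_factorE fm fJ.
have [cl cM cs] := coset_of_morphism.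
split=> [a|p|]; last 1 first.
- by elim/coset_ind=> x; rewrite -cs !fE (cstar_morphism_star fm).
- by elim/coset_ind=> x; elim/coset_ind=> y; rewrite -cl !fE (cstar_morphism_lin fm).
- elim/coset_ind: p => x; elim/coset_ind=> y.
  by rewrite -cM !fE (cstar_morphismM fm).
Qed.

Fact coset_of_surj q : exists x, coset_of x = q.
Proof. by exists (coset_repr q); exact: coset_ofK. Qed.

Fact coset_of_ker x : coset_of x = 0 <-> J x.
Proof. by rewrite coset_ofP subr0. Qed.

Definition coset_quotient : cstar_quotient J :=
  CStarQuotient coset_of_morphism coset_of_surj coset_of_ker nrm_coset.

End Quotient.

(** * Quotients given abstractly *)

Section QuotientTheory.
Variables (R : realType) (C : cstarAlgType R) (J : set C).

(** The given quotient replaces functional calculus: |q x|^2 is the norm of q (x^* x + j), at most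
    that of x^* x + j by contractivity, while |q x| is the infimum of the norms of the x + k.
    Self-adjointness of J follows because it is the kernel of a morphism. *)
Lemma cstar_ideal_of_quotient (Q : cstar_quotient J) : closed_ideal J -> cstar_ideal J.
Proof.
move=> Jc; have qm := qproj_morphism Q; split=> // [x /(qproj_ker Q) Jx|x j e Jj e0].
  by apply/(qproj_ker Q); rewrite (cstar_morphism_star qm) Jx cstar0.
set m := nrm _.
have m0 : 0 <= m by exact: nrm_ge0.
have : nrm (qproj Q x) ^+ 2 <= m.
  rewrite -nrm_cstar_mul -(cstar_morphism_star qm) -(cstar_morphismM qm).
  have -> : qproj Q (cmul (cstar x) x) = qproj Q (cmul (cstar x) x + j).
    by rewrite (cstar_morphismD qm) ((qproj_ker Q j).2 Jj) addr0.
  exact: cstar_morphism_contractive.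
(* The gap e makes the bound strict, so that some x + k stays below it. *)
move=> qm2; have : nrm (qproj Q x) < Num.sqrt (m + e).
  rewrite -[ltLHS]ger0_norm ?nrm_ge0// -sqrtr_sqr ltr_sqrt; first lra.
  by rewrite ltr_wpDl.
rewrite {1}/nrm qproj_norm => /(quotient_norm_lt Jc)[k Jk kx].
exists k => //; rewrite -[leRHS]sqr_sqrtr ?addr_ge0 ?(ltW e0)//.
by rewrite lerXn2r ?nnegrE ?sqrtr_ge0 ?nrm_ge0// ltW.
Qed.

Lemma qproj_eq (Q : cstar_quotient J) x y : qproj Q x = qproj Q y <-> J (x - y).
Proof.
rewrite -(qproj_ker Q) (cstar_morphismB (qproj_morphism Q)).
by split=> [->|/eqP]; [rewrite subrr|rewrite subr_eq0 => /eqP].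
Qed.

Lemma qproj_lift (Q : cstar_quotient J) (y : Q) (e : R) : closed_ideal J -> 0 < e ->
  exists2 x, qproj Q x = y & nrm x < nrm y + e.
Proof.
move=> Jc e0; have [x xy] := qproj_surj y.
have : nrm (qproj Q x) < nrm y + e by rewrite xy ltrDl.
rewrite {1}/nrm qproj_norm => /(quotient_norm_lt Jc)[j Jj jx].
by exists (x + j) => //; rewrite -xy; apply/qproj_eq; rewrite addrC addKr.
Qed.

End QuotientTheory.

(** * Closed unions of increasing sequences of ideals *)

Section IncreasingUnion.
Variables (R : realType) (C : cstarAlgType R) (J : nat -> set C).
Hypothesis Jincr : forall k, J k `<=` J k.+1.

Lemma increasing_subset k l : (k <= l)%N -> J k `<=` J l.
Proof.
move=> /subnK <-; elim: (l - k)%N => // d IH x /IH; rewrite addSn; exact: Jincr.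
Qed.

Lemma closed_ideal_closure_bigcup : (forall k, closed_ideal (J k)) ->
  closed_ideal (closure (\bigcup_k J k)).
Proof.
move=> Jc; have Joo := @subset_closure C (\bigcup_k J k).
split.
- by apply: Joo; exists 0%N => //; exact: closed_ideal0.
- move=> a x y /closure_nrmP xJ /closure_nrmP yJ; apply/closure_nrmP => e e0.
  pose c := complex.Re `|a|; have c0 : 0 <= c := Re_norm_ge0 a.
  (* Dividing by c + 1 instead of c covers the case a = 0. *)
  have c1 : 0 < c + 1 by lra.
  have [|x' [k _ kx] xx] := xJ (e / 2 / (c + 1)); first by rewrite !divr_gt0.
  have [|y' [l _ ly] yy] := yJ (e / 2); first by rewrite divr_gt0.
  exists (a *: x' + y').
    exists (maxn k l) => //; have [_ + _ _] := Jc (maxn k l); apply.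
      exact: increasing_subset (leq_maxl _ _) _ kx.
    exact: increasing_subset (leq_maxr _ _) _ ly.
  rewrite opprD addrACA -scalerBr (le_lt_trans (nrmD _ _))// nrmZ -/c.
  have : c * nrm (x - x') <= (c + 1) * nrm (x - x') by rewrite ler_wpM2r ?nrm_ge0//; lra.
  by move: xx; rewrite ltr_pdivlMr// mulrC; lra.
- move=> c x /closure_nrmP xJ; pose m := nrm c + 1.
  have m0 : 0 < m by have := nrm_ge0 c; rewrite /m; lra.
  have near (e : R) : 0 < e -> exists x', [/\ (\bigcup_k J k) (cmul c x'),
      (\bigcup_k J k) (cmul x' c), nrm (cmul c (x - x')) < e & nrm (cmul (x - x') c) < e].
    move=> e0; have [|x' [k _ kx] xx] := xJ (e / m); first by rewrite divr_gt0.
    have : nrm c * nrm (x - x') < e.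
      move: xx; rewrite ltr_pdivlMr// mulrC; apply: le_lt_trans.
      by rewrite ler_wpM2r ?nrm_ge0// /m lerDl.
    move=> ce; exists x'; split.
    + by exists k => //; exact: closed_ideal_mulr.
    + by exists k => //; exact: closed_ideal_mull.
    + exact: le_lt_trans (nrmM _ _) _.
    + by apply: le_lt_trans (nrmM _ _) _; rewrite mulrC.
  by split; apply/closure_nrmP => e /near[x' [? ? ? ?]];
    [exists (cmul c x')|exists (cmul x' c)]; rewrite -?cmulBr -?cmulBl.
- exact: closed_closure.
Qed.

Lemma cstar_ideal_closure_bigcup : (forall k, cstar_ideal (J k)) ->
  cstar_ideal (closure (\bigcup_k J k)).
Proof.
move=> Jg; split.
- by apply: closed_ideal_closure_bigcup => k; exact: cstar_ideal_closed.
- move=> x /closure_nrmP xJ; apply/closure_nrmP => e /xJ[y [k _ ky] xy].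
  exists (cstar y); last by rewrite -cstarB nrm_cstar.
  by exists k => //; have [_ + _] := Jg k; exact.
- move=> x j e /closure_nrmP jJ e0.
  have [|j' [k _ kj] jj] := jJ (e / 2); first by rewrite divr_gt0.
  have [_ _ /(_ x j' (e / 2) kj)[|i Ji xi]] := Jg k; first by rewrite divr_gt0.
  exists i; first by apply: subset_closure; exists k.
  have := nrm_le_dist (cmul (cstar x) x + j') (cmul (cstar x) x + j).
  by rewrite opprD addrACA subrr add0r (nrm_distrC j'); lra.
Qed.

End IncreasingUnion.

(** * Sequence algebras and stability of liftability *)

Lemma null_seqP (R : realType) (u : nat -> R) : (forall n, 0 <= u n) ->
  u @ \oo --> (0 : R) <->
  forall e, 0 < e -> exists N, forall n, (N <= n)%N -> u n < e.
Proof.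
move=> u0; split=> [/cvgrPdist_lt cu e e0|H].
  have [N _ NP] := cu e e0; exists N => n /NP /=.
  by rewrite sub0r normrN ger0_norm.
apply/cvgrPdist_lt => e /H[N NP]; exists N => // n /= /NP.
by rewrite sub0r normrN ger0_norm.
Qed.

Lemma null_seq_le (R : realType) (u v : nat -> R) (N : nat) :
  (forall n, (N <= n)%N -> 0 <= u n <= v n) ->
  v @ \oo --> (0 : R) -> u @ \oo --> (0 : R).
Proof.
move=> uv; apply: squeeze_cvgr (cvg_cst 0).
by exists N.
Qed.

Definition product_space (R : realType) (T : Type) (B : T -> cstarAlgType R) :
    section_space R :=
  @SectionSpace R T B setT Logic.I (fun _ _ _ _ _ => Logic.I)
    (fun _ _ _ _ => Logic.I) (fun _ _ => Logic.I) (fun _ _ => Logic.I).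

Section SequenceAlgebra.
Variables (R : realType) (B : nat -> cstarAlgType R).
Local Notation E := (bsection (product_space B)).

Definition bounded_seq (f : forall n, B n) (M : R) (fM : forall n, nrm (f n) <= M) : E :=
  @BSection R (product_space B) f Logic.I (ex_intro _ M fM).

Variables (I : forall n, set (B n)) (Ig : forall n, cstar_ideal (@I n)).

(** The ideals I n may vary with n. Lifting problems take them all equal to J; inductive limits take
    them to be the whole algebras, so that [null_quotient] is the algebra of bounded sequences
    modulo null sequences. *)
Definition cutoff_ideal (k : nat) : set E :=
  [set c : E | forall n, I (c n) /\ ((k <= n)%N -> c n = 0)].

Definition null_ideal : set E := closure (\bigcup_k cutoff_ideal k).

Lemma cutoff_ideal_incr k : cutoff_ideal k `<=` cutoff_ideal k.+1.
Proof. by move=> c ck n; have [cI c0] := ck n; split=> // /ltnW. Qed.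

Lemma closed_cutoff_ideal k : closed_ideal (cutoff_ideal k).
Proof.
have Ic n := cstar_ideal_closed (Ig n); split.
- by move=> n; split=> //; exact: closed_ideal0.
- move=> a x y xk yk n; have [[xI x0] [yI y0]] := (xk n, yk n).
  rewrite bsecDE bsecZE; split=> [|kn]; last by rewrite x0 ?y0 ?scaler0 ?addr0.
  by have [_ + _ _] := Ic n; apply.
- move=> c x xk; split=> n; have [xI x0] := xk n.
    by split=> [|kn]; [exact: closed_ideal_mulr|rewrite [LHS]/= x0 ?cmul0r].
  by split=> [|kn]; [exact: closed_ideal_mull|rewrite [LHS]/= x0 ?cmul0l].
- apply/closed_nrmP => x Hx n; split=> [|kn].
    apply: closed_ideal_nrm => // e /Hx[y /(_ n)[yI _] xy]; exists (y n) => //.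
    by rewrite -bsecBE (le_lt_trans (nrm_bsec_ub _ _)).
  apply: nrm0_eq0; apply/le_anti; rewrite nrm_ge0 andbT; apply/ler_addgt0Pr => e.
  move=> /Hx[y /(_ n)[_ y0] xy]; rewrite add0r -[x n]subr0 -(y0 kn) -bsecBE.
  by rewrite (le_trans (nrm_bsec_ub _ _))// ltW.
Qed.

(** The correction j' is chosen in each coordinate, as 0 from k on. It is a bounded sequence because
    every x n + h n has norm at most the square root of m, a bound common to all coordinates. *)
Lemma cstar_cutoff_ideal k : cstar_ideal (cutoff_ideal k).
Proof.
split; first exact: closed_cutoff_ideal.
  move=> x xk n; have [xI x0] := xk n; split=> [|kn].
    by have [_ + _] := Ig n; exact.
  by rewrite [LHS]/= x0// cstar0.
move=> x j e jk e0; set m := nrm _ + e.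
have m0 : 0 <= m by rewrite addr_ge0 ?nrm_ge0// ltW.
have hex n : exists h : B n, [/\ I h, (k <= n)%N -> h = 0 & nrm (x n + h) ^+ 2 <= m].
  have := nrm_bsec_ub (cmul (cstar x) x + j) n; rewrite bsecDE => xj.
  have [jI j0] := jk n.
  have [kn|nk] := leqP k n.
    exists 0; split=> //; first exact: closed_ideal0 (cstar_ideal_closed (Ig n)).
    rewrite addr0 -nrm_cstar_mul; move: xj; rewrite j0// addr0.
    by move=> /le_trans; apply; rewrite lerDl ltW.
  have [_ _ /(_ (x n) (j n) e jI e0)[h hI hx]] := Ig n.
  by exists h; split=> //; rewrite (le_trans hx)// lerD2r.
pose h n := sval (cid (hex n)).
have hP n : [/\ I (h n), (k <= n)%N -> h n = 0 & nrm (x n + h n) ^+ 2 <= m].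
  exact: (svalP (cid (hex n))).
have hs n : nrm (x n + h n) <= Num.sqrt m.
  by rewrite -[leLHS]ger0_norm ?nrm_ge0// -sqrtr_sqr ler_sqrt//; have [] := hP n.
have hb n : nrm (h n) <= nrm x + Num.sqrt m.
  rewrite (le_trans (nrm_le_dist _ (- x n)))// opprK nrmN [h n + _]addrC.
  by rewrite lerD// nrm_bsec_ub.
exists (bounded_seq hb) => [n|]; first by have [hI h0 _] := hP n.
rewrite -[leRHS]sqr_sqrtr// lerXn2r ?nnegrE ?nrm_ge0 ?sqrtr_ge0//.
by apply: nrm_bsec_le => [|n]; rewrite ?sqrtr_ge0// bsecDE.
Qed.

Lemma cstar_null_ideal : cstar_ideal null_ideal.
Proof.
by apply: cstar_ideal_closure_bigcup; [exact: cutoff_ideal_incr|exact: cstar_cutoff_ideal].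
Qed.

Lemma null_idealP (c : E) : null_ideal c <->
  (forall n, I (c n)) /\ (fun n => nrm (c n)) @ \oo --> (0 : R).
Proof.
have cge0 n : 0 <= nrm (c n) by exact: nrm_ge0.
split=> [/closure_nrmP cJ|[cI /(null_seqP cge0) c0]].
  split=> [n|].
    apply: closed_ideal_nrm; first exact: cstar_ideal_closed.
    move=> e /cJ[y [k _ /(_ n)[yI _]] cy]; exists (y n) => //.
    by rewrite -bsecBE (le_lt_trans (nrm_bsec_ub _ _)).
  apply/(null_seqP cge0) => e /cJ[y [k _ yk] cy].
  exists k => n kn; have [_ y0] := yk n.
  by rewrite -[c n]subr0 -(y0 kn) -bsecBE (le_lt_trans (nrm_bsec_ub _ _)).
apply/closure_nrmP => e e0.
have [|N NP] := c0 (e / 2); first by rewrite divr_gt0.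
(* Truncation at N puts the sequence in the N-th cutoff ideal and changes it by at most e / 2. *)
pose d n : B n := if (n < N)%N then c n else 0.
have db n : nrm (d n) <= nrm c.
  by rewrite /d; case: ifP => _; [exact: nrm_bsec_ub|rewrite nrm0 nrm_ge0].
exists (bounded_seq db).
  exists N => // n; split; rewrite /= /d.
    by case: ifP => // _; exact: closed_ideal0 (cstar_ideal_closed (Ig n)).
  by rewrite leqNgt => /negbTE ->.
rewrite (@le_lt_trans _ _ (e / 2))//; last lra.
apply: nrm_bsec_le => [|n]; first lra.
rewrite bsecBE /= /d; case: ltnP => nN; first by rewrite subrr nrm0; lra.
by rewrite subr0 ltW// NP.
Qed.

Definition null_quotient : cstar_quotient null_ideal := coset_quotient cstar_null_ideal.

(** Semiprojectivity for the cutoff ideals gives a lift modulo the k-th one. Elements of that ideal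
    vanish from k on, so the later coordinates of the lift are well-defined morphisms. The
    conclusion holds for every representative s of sigma a, so that it can be compared with explicit
    sequences. *)
Lemma semiprojective_lift_sequence (A : cstarAlgType R) (sigma : A -> null_quotient) :
  semiprojective A -> cstar_morphism sigma ->
  exists k (psi : forall n, A -> B n), (forall n, cstar_morphism (psi n)) /\
    forall a (s : E), coset_of cstar_null_ideal s = sigma a ->
      (forall n, (k <= n)%N -> I (psi n a - s n)) /\
      (fun n => nrm (psi n a - s n)) @ \oo --> (0 : R).
Proof.
move=> Asp sm; pose Q k := coset_quotient (cstar_cutoff_ideal k).
pose pi k (q : Q k) : null_quotient := coset_of cstar_null_ideal (coset_repr q).
have piE k (x : E) : pi k (qproj (Q k) x) = qproj null_quotient x.
  apply/coset_ofP; apply: subset_closure; exists k => //; exact: coset_reprK.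
have [k [psi psim psiE]] :=
  Asp _ _ closed_cutoff_ideal cutoff_ideal_incr Q null_quotient pi piE sigma sm.
(* Coordinates below k depend on the representative, hence the default 0 there. *)
exists k, (fun n a => if (k <= n)%N then coset_repr (psi a) n else 0).
split=> [n|a s sE].
  case: leqP => kn; last exact: cstar_morphism_zero.
  apply: (@cstar_morphism_comp _ _ (Q k) _ psi (fun q => coset_repr q n) psim).
  apply: (@coset_factor_morphism _ _ _ _ _ (fun c : E => c n)) => [|x /(_ n)[_]].
    exact: bsec_eval_morphism.
  exact.
have /coset_ofP/null_idealP[dI d0] : coset_of cstar_null_ideal (coset_repr (psi a)) =
    coset_of cstar_null_ideal s by rewrite sE -psiE.
split=> [n kn|]; first by rewrite kn; have := dI n; rewrite bsecBE.
apply: (@null_seq_le _ _ _ k) d0 => n kn.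
by rewrite kn bsecBE nrm_ge0 lexx.
Qed.

End SequenceAlgebra.

Definition liftable (R : realType) (A C : cstarAlgType R) (J : set C)
    (Q : cstar_quotient J) (f : A -> Q) : Prop :=
  exists2 psi : A -> C, cstar_morphism psi & forall x, qproj Q (psi x) = f x.

(** Adding to lam n a a small lift of the error gives a lift of chi n a that is not multiplicative
    or linear in a. Its defects lie in J, as chi n is a morphism, and tend to 0, as lam n is a
    morphism; they vanish in [null_quotient]. *)
Lemma liftable_of_cvg (R : realType) (A C : cstarAlgType R) (J : set C)
    (Q : cstar_quotient J) (lam : nat -> A -> C) (chi : nat -> A -> Q) :
  semiprojective A -> closed_ideal J ->
  (forall n, cstar_morphism (lam n)) -> (forall n, cstar_morphism (chi n)) ->
  (forall a, (fun n => nrm (chi n a - qproj Q (lam n a))) @ \oo --> (0 : R)) ->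
  exists n, liftable (chi n).
Proof.
move=> Asp Jc lm cm cvg0; have Jg := cstar_ideal_of_quotient Q Jc.
(* The slack 1/(n+1), needed because the quotient norm is an infimum, tends to 0 with n. *)
have eex (na : nat * A) : exists e : C,
    qproj Q e = chi na.1 na.2 - qproj Q (lam na.1 na.2) /\
    nrm e < nrm (chi na.1 na.2 - qproj Q (lam na.1 na.2)) + na.1.+1%:R^-1.
  have [|e eE en] := @qproj_lift _ _ _ Q (chi na.1 na.2 - qproj Q (lam na.1 na.2))
    na.1.+1%:R^-1 Jc; first by rewrite invr_gt0 ltr0n.
  by exists e.
have /choice[e' eP] := eex; pose e n a := e' (n, a).
have eQ n a : qproj Q (e n a) = chi n a - qproj Q (lam n a) by have [] := eP (n, a).
have e0 a : (fun n => nrm (e n a)) @ \oo --> (0 : R).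
  apply: (@null_seq_le _ _ (fun n => nrm (chi n a - qproj Q (lam n a)) + n.+1%:R^-1) 0%N).
    by move=> n _; rewrite nrm_ge0 ltW//; have [] := eP (n, a).
  by rewrite -[X in _ --> X]addr0; apply: cvgD => //; exact: cvg_harmonic.
pose s' n a := lam n a + e n a.
(* By contractivity the error has norm at most 2|a|, and the slack is at most 1. *)
have sb a n : nrm (s' n a) <= nrm a + (nrm a + nrm a + 1).
  rewrite (le_trans (nrmD _ _))// lerD//; first exact: cstar_morphism_contractive.
  have [_ /ltW/le_trans] := eP (n, a); apply; rewrite lerD//.
    rewrite (le_trans (nrmB _ _))// lerD//; first exact: cstar_morphism_contractive.
    rewrite (le_trans (cstar_morphism_contractive (qproj_morphism Q) _))//.
    exact: cstar_morphism_contractive.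
  by rewrite invf_le1 ?ler1n ?ltr0n.
pose s a := bounded_seq (sb a).
have sQ n a : qproj Q (s' n a) = chi n a.
  by rewrite (cstar_morphismD (qproj_morphism Q)) eQ addrC subrK.
pose Ig (n : nat) := Jg.
pose sigma (a : A) : null_quotient Ig := coset_of (cstar_null_ideal Ig) (s a).
have qm := qproj_morphism Q.
have sm : cstar_morphism sigma.
  have [cl cM cs] := coset_of_morphism (cstar_null_ideal Ig).
  split=> [c x y|x y|x]; rewrite /sigma -?cl -?cM -?cs; apply/coset_ofP/(null_idealP Ig).
  - split=> [n|].
      rewrite bsecBE bsecDE bsecZE /=; apply/(qproj_eq Q).
      by rewrite (cstar_morphism_lin qm) !sQ (cstar_morphism_lin (cm n)).
    apply: (@null_seq_le _ _ (fun n => nrm (e n (c *: x + y)) +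
      (complex.Re `|c| * nrm (e n x) + nrm (e n y))) 0%N) => [n _|].
      rewrite nrm_ge0 bsecBE bsecDE bsecZE /= /s' (cstar_morphism_lin (lm n)).
      rewrite scalerDr addrACA opprD addrACA subrr add0r.
      by rewrite (le_trans (nrmB _ _))// lerD// (le_trans (nrmD _ _))// nrmZ.
    rewrite -[X in _ --> X]addr0 -[X in _ --> _ + X]addr0; apply: cvgD => //.
    by apply: cvgD => //; rewrite -[X in _ --> X](mulr0 (complex.Re `|c|)); exact: cvgMr.
  - split=> [n|].
      rewrite bsecBE /=; apply/(qproj_eq Q).
      by rewrite (cstar_morphismM qm) !sQ (cstar_morphismM (cm n)).
    apply: (@null_seq_le _ _ (fun n => nrm (e n (cmul x y)) +
      (nrm x * nrm (e n y) + nrm (s y) * nrm (e n x))) 0%N) => [n _|].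
      rewrite nrm_ge0 bsecBE /=.
      (* The products of the lam n cancel, and every remaining term has a factor e n. *)
      have -> : s' n (cmul x y) - cmul (s' n x) (s' n y) =
          e n (cmul x y) - (cmul (lam n x) (e n y) + cmul (e n x) (s' n y)).
        rewrite /s' (cstar_morphismM (lm n)) [cmul (lam n x + _) _]cmulDl.
        by rewrite [cmul (lam n x) (_ + _)]cmulDr -[X in _ - X]addrA opprD addrACA subrr add0r.
      rewrite (le_trans (nrmB _ _))// lerD// (le_trans (nrmD _ _))// lerD//.
        rewrite (le_trans (nrmM _ _))// ler_wpM2r ?nrm_ge0//.
        exact: cstar_morphism_contractive.
      rewrite (le_trans (nrmM _ _))// mulrC ler_wpM2r ?nrm_ge0//.
      exact: (nrm_bsec_ub (s y) n).
    rewrite -[X in _ --> X]addr0 -[X in _ --> _ + X]addr0; apply: cvgD => //.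
    apply: cvgD; [rewrite -[X in _ --> X](mulr0 (nrm x))
                 |rewrite -[X in _ --> X](mulr0 (nrm (s y)))]; exact: cvgMr.
  - split=> [n|].
      rewrite bsecBE /=; apply/(qproj_eq Q).
      by rewrite (cstar_morphism_star qm) !sQ (cstar_morphism_star (cm n)).
    apply: (@null_seq_le _ _ (fun n => nrm (e n (cstar x)) + nrm (e n x)) 0%N) => [n _|].
      rewrite nrm_ge0 bsecBE /= /s' (cstar_morphism_star (lm n)).
      rewrite cstarD opprD addrACA subrr add0r.
      by rewrite (le_trans (nrmB _ _))// nrm_cstar.
    by rewrite -[X in _ --> X]addr0; exact: cvgD.
have [k [psi [psim psiE]]] := semiprojective_lift_sequence Asp sm.
(* From index k on, psi n a and s n a differ by an element of J, so psi k lifts chi k exactly. *)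
exists k, (psi k) => // a; have [/(_ k (leqnn k)) + _] := psiE a (s a) erefl.
by move=> /(qproj_eq Q) ->; exact: sQ.
Qed.

(** * Cones and homotopies *)

Lemma cvg_nrmP (R : realType) (V : normedModType R[i]) (T : Type)
    (F : set_system T) {FF : Filter F} (f : T -> V) (l : V) :
  f @ F --> l <-> (fun x => nrm (f x - l)) @ F --> (0 : R).
Proof.
split=> [fl|/cvgrPdist_lt fl P /nbhs_nrmP[e e0 eP]].
  apply/cvgrPdist_lt => e e0; apply: (fl [set y | `|0 - nrm (y - l)| < e]).
  apply/nbhs_nrmP; exists e => // y ly.
  by rewrite /= sub0r normrN ger0_norm ?nrm_ge0// nrm_distrC.
apply: filterS (fl e e0) => x; rewrite sub0r normrN ger0_norm ?nrm_ge0// => xl.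
by apply: eP; rewrite nrm_distrC.
Qed.

Lemma nrm_squeeze0 (R : realType) (V : normedModType R[i]) (T : Type)
    (F : set_system T) {FF : Filter F} (f : T -> V) (g : T -> R) :
  (forall x, nrm (f x) <= g x) -> g @ F --> (0 : R) ->
  (fun x => nrm (f x)) @ F --> (0 : R).
Proof.
move=> fg; apply: squeeze_cvgr (cvg_cst 0).
by apply: nearW => x; rewrite nrm_ge0 fg.
Qed.

Section Cone.
Variables (R : realType) (A : cstarAlgType R).
Implicit Types f g : R -> A.

(** Functions on the whole line stand in for functions on [0,1], so that continuity involves no
    subspace topology; paths are restricted to [0,1] at the end. *)
Definition cone_pred : set (R -> A) := [set f : R -> A | continuous f /\ f 1 = 0].

Let contP f : continuous f <-> forall t, (fun s => nrm (f s - f t)) @ t --> (0 : R).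
Proof. by split=> H t; apply/cvg_nrmP; exact: H. Qed.

Fact cone0 : cone_pred (fun=> 0).
Proof. by split=> // t; exact: cvg_cst. Qed.

Fact cone_lin (a : R[i]) f g : cone_pred f -> cone_pred g ->
  cone_pred (fun t => a *: f t + g t).
Proof.
move=> [fc f1] [gc g1]; split; last by rewrite f1 g1 scaler0 addr0.
by move=> t; apply: cvgD; [apply: cvgZr; exact: fc|exact: gc].
Qed.

Fact cone_mul f g : cone_pred f -> cone_pred g -> cone_pred (fun t => cmul (f t) (g t)).
Proof.
move=> [/contP fc f1] [/contP gc g1]; split; last by rewrite f1 cmul0l.
apply/contP => t; apply: (@nrm_squeeze0 _ _ _ _ _ _
  (fun s => nrm (f s - f t) * nrm (g s - g t) + (nrm (f s - f t) * nrm (g t) +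
    nrm (f t) * nrm (g s - g t)))) => [s|].
  have -> : cmul (f s) (g s) - cmul (f t) (g t) = cmul (f s - f t) (g s - g t) +
      (cmul (f s - f t) (g t) + cmul (f t) (g s - g t)).
    by rewrite addrA -cmulDr subrK cmulBr cmulBl addrA subrK.
  by rewrite (le_trans (nrmD _ _))// lerD ?nrmM// (le_trans (nrmD _ _))// lerD ?nrmM.
rewrite -[X in _ --> X]addr0 -[X in _ --> _ + X]addr0.
apply: cvgD; first by rewrite -[X in _ --> X](mulr0 0); apply: cvgM.
apply: cvgD; first by rewrite -[X in _ --> X](mul0r (nrm (g t))); apply: cvgMl.
by rewrite -[X in _ --> X](mulr0 (nrm (f t))); apply: cvgMr.
Qed.

Fact cone_star f : cone_pred f -> cone_pred (fun t => cstar (f t)).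
Proof.
move=> [/contP fc f1]; split; last by rewrite f1 cstar0.
apply/contP => t; apply: nrm_squeeze0 (fc t) => s.
by rewrite -cstarB nrm_cstar.
Qed.

Fact cone_uniform f :
  (forall e : R, 0 < e -> exists2 g, cone_pred g & forall t, nrm (f t - g t) <= e) ->
  cone_pred f.
Proof.
move=> H; split; last first.
  apply: nrm0_eq0; apply/le_anti; rewrite nrm_ge0 andbT; apply/ler_addgt0Pr => e.
  by move=> /H[g [_ g1] /(_ 1)]; rewrite g1 subr0 add0r.
apply/contP => t; apply/cvgrPdist_lt => e e0.
have [|g [/contP/(_ t)/cvgrPdist_lt/(_ (e / 3)) gc _] fg] := H (e / 3).
  by rewrite divr_gt0.
have e3 : 0 < e / 3 by rewrite divr_gt0.
apply: filterS (gc e3) => s; rewrite !sub0r !normrN !ger0_norm ?nrm_ge0// => gst.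
have := nrm_triangle (g s) (f s) (f t); have := nrm_triangle (g t) (g s) (f t).
by have := fg s; have := fg t; rewrite (nrm_distrC (f t)); lra.
Qed.

Definition cone_space : section_space R :=
  @SectionSpace R R (fun=> A) cone_pred cone0 cone_lin cone_mul cone_star cone_uniform.
Local Notation cone := (bsection cone_space).

(** The cosine factor is continuous, equals 1 at 0 and 0 at 1, and is bounded by 1 on the whole
    line: this is a norm-preserving section of evaluation at 0. *)
Let damp (a : A) (t : R) : A := (cos (pi / 2 * t))%:C%C *: a.

Let damp_cone a : cone_pred (damp a).
Proof.
split; last by rewrite /damp mulr1 cos_pihalf scale0r.
apply/contP => t; apply: (@nrm_squeeze0 _ _ _ _ _ _
  (fun s => `|cos (pi / 2 * s) - cos (pi / 2 * t)| * nrm a)) => [s|].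
  by rewrite /damp -scalerBl -rmorphB nrmZr.
rewrite -[X in _ --> X](mul0r (nrm a)); apply: cvgMl.
have : (fun s => cos (pi / 2 * s)) @ t --> cos (pi / 2 * t).
  apply: (@cvg_comp _ _ _ (fun s => pi / 2 * s) cos); last exact: continuous_cos.
  by apply: cvgMr; exact: cvg_id.
by move=> /cvgr_distC_lt ct; apply/cvgrPdist_lt => e /ct; apply: filterS => s;
  rewrite sub0r normrN normr_id distrC.
Qed.

Let damp_bound a t : nrm (damp a t) <= nrm a.
Proof. by rewrite /damp nrmZr ler_piMl ?nrm_ge0// ler_norml cos_geN1 cos_le1. Qed.

Definition damped (a : A) : cone :=
  @BSection R cone_space (damp a) (damp_cone a) (ex_intro _ (nrm a) (damp_bound a)).

Lemma damped0 a : damped a 0 = a.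
Proof. by rewrite /= /damp mulr0 cos0 scale1r. Qed.

Lemma nrm_damped a : nrm (damped a) <= nrm a.
Proof. by apply: nrm_bsec_le => [|t]; [exact: nrm_ge0|exact: damp_bound]. Qed.

Definition cone_kernel : set cone := [set f : cone | f 0 = 0].

Lemma closed_cone_kernel : closed_ideal cone_kernel.
Proof.
rewrite /cone_kernel; split=> /=.
- by [].
- by move=> a f g f0 g0; rewrite !addr0 !scale1r f0 g0 scaler0 addr0.
- by move=> c f f0; rewrite f0 cmul0l cmul0r.
- apply/closed_nrmP => f Hf; apply: nrm0_eq0; apply/le_anti; rewrite nrm_ge0 andbT.
  apply/ler_addgt0Pr => e /Hf[g /= g0 fg]; rewrite add0r -[f 0]subr0 -g0 -bsecBE.
  by rewrite (le_trans (nrm_bsec_ub _ _))// ltW.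
Qed.

Fact cone_eval_surj (a : A) : exists f : cone, f 0 = a.
Proof. by exists (damped a); exact: damped0. Qed.

Fact cone_eval_norm (f : cone) :
  complex.Re `|f 0| = inf [set complex.Re `|f + j| | j in cone_kernel].
Proof.
apply/le_anti/andP; split.
  apply: (@le_quotient_norm _ _ cone_kernel); first exact: closed_cone_kernel.
  move=> j j0; have := nrm_bsec_ub (f + j) 0.
  by rewrite bsecDE j0 addr0.
(* The infimum is attained: [damped (f 0)] is congruent to f and has norm at most that of f 0. *)
have j0 : cone_kernel (damped (f 0) - f).
  by rewrite /cone_kernel /mkset bsecBE damped0 subrr.
rewrite (le_trans (quotient_norm_le f j0))//.
by rewrite addrC subrK nrm_damped.
Qed.

Definition cone_quotient : cstar_quotient cone_kernel :=
  @CStarQuotient R cone cone_kernel A (fun f : cone => f 0)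
    (@bsec_eval_morphism R cone_space 0) cone_eval_surj
    (fun _ => iff_refl _) cone_eval_norm.

(** Evaluation at 0 presents A as a quotient of the cone. A lift of the identity sends a to a path
    from a to 0, which is a contraction of A. *)
Lemma projective_contractible : projective A -> contractible A.
Proof.
move=> Ap; have [psi psim psiE] :=
  Ap _ _ closed_cone_kernel cone_quotient (fun x => x) (@cstar_morphism_id _ A).
exists (fun a t => psi a t); split=> [a|t _|a|a].
- by apply: continuous_subspaceT => t; have [+ _] := bsec_pred (psi a); apply.
- exact: (cstar_morphism_comp psim (@bsec_eval_morphism R cone_space t)).
- exact: psiE.
- by have [_] := bsec_pred (psi a).
Qed.

End Cone.

(** * Homotopy invariance of liftability *)

Section HomotopyLifting.
Variable R : realType.
Implicit Types A B C D : cstarAlgType R.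

Lemma homotopic_sym A B (f g : A -> B) : homotopic f g -> homotopic g f.
Proof.
move=> [Phi [Pc Pm P0 P1]]; have rev (t : R) : t \in `[0, 1] -> 1 - t \in `[0, 1].
  by rewrite !in_itv /= => /andP[? ?]; apply/andP; split; lra.
exists (fun a t => Phi a (1 - t)); split=> [a|t /rev t01|a|a].
- apply/subspace_continuousP => t t01 P.
  have /subspace_continuousP/(_ (1 - t) (rev _ t01) P) := Pc a.
  move=> H /H /= [e /= e0 eP]; exists e => //= s.
  move=> st s01; apply: (eP (1 - s)); last exact: rev.
  rewrite /= in st *; have -> : 1 - t - (1 - s) = - (t - s) by lra.
  by rewrite normrN.
- exact: Pm.
- by rewrite subr0 P1.
- by rewrite subrr P0.
Qed.

Lemma homotopic_comp A B C D (a : A -> B) (f g : B -> C) (b : C -> D) :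
  cstar_morphism a -> cstar_morphism b -> homotopic f g ->
  homotopic (fun x => b (f (a x))) (fun x => b (g (a x))).
Proof.
move=> am bm [Phi [Pc Pm P0 P1]]; exists (fun x t => b (Phi (a x) t)).
split=> [x|t t01|x|x]; rewrite ?P0 ?P1//; last first.
  exact: (cstar_morphism_comp (cstar_morphism_comp am (Pm t t01)) bm).
apply/subspace_continuousP => t t01.
have /subspace_continuousP/(_ t t01)/cvg_nrmP H := Pc (a x).
apply/cvg_nrmP; apply: nrm_squeeze0 H => s.
by rewrite -(cstar_morphismB bm); exact: cstar_morphism_contractive.
Qed.

Lemma liftable_cvg A C (J : set C) (Q : cstar_quotient J) (f g : nat -> A -> Q) :
  semiprojective A -> closed_ideal J ->
  (forall n, liftable (f n)) -> (forall n, cstar_morphism (g n)) ->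
  (forall a, (fun n => nrm (g n a - f n a)) @ \oo --> (0 : R)) ->
  exists n, liftable (g n).
Proof.
move=> Asp Jc fl gm fg.
have /choice[lam lamP] : forall n, exists l : A -> C,
    cstar_morphism l /\ forall x, qproj Q (l x) = f n x.
  by move=> n; have [l lm lf] := fl n; exists l.
apply: (liftable_of_cvg (lam := lam)) => // [n|a]; first by have [] := lamP n.
by under eq_fun do rewrite (lamP _).2; exact: fg.
Qed.

(** Stability is used twice at the supremum t of the parameters with liftable morphism: once to show
    that t is itself such a parameter, once to find larger ones if t < 1. *)
Lemma homotopic_liftable A C (J : set C) (Q : cstar_quotient J) (f g : A -> Q) :
  semiprojective A -> closed_ideal J -> homotopic f g -> liftable f -> liftable g.
Proof.
move=> Asp Jc [Phi [Pc Pm P0 P1]] fl.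
have seqc (u : nat -> R) (t : R) : (forall n, u n \in `[0, 1]) -> t \in `[0, 1] ->
    u @ \oo --> t -> forall a, (fun n => Phi a (u n)) @ \oo --> Phi a t.
  move=> u01 t01 ut a P.
  have /subspace_continuousP/(_ t t01 P) H := Pc a.
  by move=> /H /ut[N _ NP]; exists N => // n /NP; apply; exact: u01.
pose T := [set t : R | t \in `[0, 1] /\ liftable (Phi^~ t)].
have T0 : T 0.
  split; first by rewrite in_itv /= lexx ler01.
  by have [l lm lf] := fl; exists l => // x; rewrite lf P0.
have Tub : ubound T 1 by move=> t [+ _]; rewrite in_itv /= => /andP[].
have Ts : has_sup T by split; [exists 0|exists 1].
pose t := sup T.
have tT s : T s -> s <= t by move=> Ts'; exact: ub_le_sup Ts.2 _ Ts'.
have t01 : t \in `[0, 1].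
  by rewrite in_itv /= tT//= ge_sup//; exists 0.
have cvgt (c : R) : (fun n => t + c * n.+1%:R^-1) @ \oo --> t.
  rewrite -[X in _ --> X]addr0 -[X in _ --> _ + X](mulr0 c).
  by apply: cvgD; [exact: cvg_cst|apply: cvgMr; exact: cvg_harmonic].
(* The approximants are the Phi at points of T converging to t; the limit family is constant. *)
have [_ tl] : T t.
  split=> //.
  have /choice[s sP] : forall n : nat, exists s, T s /\ t + -1 * n.+1%:R^-1 < s.
    move=> n; have [|s sT ts] := @sup_adherent _ T (n.+1%:R^-1) _ Ts.
      by rewrite invr_gt0 ltr0n.
    by exists s; split=> //; rewrite mulN1r.
  have [//|//|n|n|a|_ //] :=
    @liftable_cvg A C J Q (fun n => Phi^~ (s n)) (fun n => Phi^~ t).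
  - by have [[]] := sP n.
  - exact: Pm.
  - have st : s @ \oo --> t.
      apply: squeeze_cvgr (cvgt (-1)) (cvg_cst t).
      by apply: nearW => n; have [/tT st /ltW ts] := sP n; rewrite ts st.
    have s01 n : s n \in `[0, 1] by have [[]] := sP n.
    have /cvg_nrmP := seqc s t s01 t01 st a.
    by under eq_fun do rewrite nrm_distrC.
have [t1|t1] := eqVneq t 1.
  by have [l lm lf] := tl; exists l => // x; rewrite lf t1 P1.
have tlt1 : t < 1 by move: t01; rewrite lt_neqAle t1 in_itv /= => /andP[].
(* The roles are exchanged: the constant Phi at t approximates the Phi at u n, which lie in (t, 1]
   and decrease to t. One of them lifts, contradicting the choice of t. *)
pose u (n : nat) := t + (1 - t) * n.+1%:R^-1.
have u01 n : u n \in `[0, 1].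
  have i0 : 0 < n.+1%:R^-1 :> R by rewrite invr_gt0 ltr0n.
  have i1 : n.+1%:R^-1 <= 1 :> R by rewrite invf_le1 ?ler1n ?ltr0n.
  have := tT _ T0; rewrite in_itv /u /=.
  have : (1 - t) * n.+1%:R^-1 <= (1 - t) * 1 by rewrite ler_wpM2l// subr_ge0 ltW.
  have : 0 <= (1 - t) * n.+1%:R^-1 by rewrite mulr_ge0 ?(ltW i0)// subr_ge0 ltW.
  by rewrite mulr1 => t2 t3 t4; rewrite addr_ge0//= -lerBrDl.
have [//|//|n|n|a|n ul] := @liftable_cvg A C J Q (fun=> Phi^~ t) (fun n => Phi^~ (u n)).
- exact: tl.
- exact: Pm.
- by apply/cvg_nrmP; apply: seqc => //; exact: cvgt.
have /tT : T (u n) by [].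
by rewrite /u gerDl leNgt mulr_gt0// ?subr_gt0.
Qed.

End HomotopyLifting.

(** * Inductive limits *)

Section Orbits.
Variables (R : realType) (S : inductive_system R).

(* [place x m] is [x] if [m = n] and [0] otherwise; with it, forward orbits are
   defined without transporting along equalities of indices. *)
Definition place (n : nat) (x : S n) (m : nat) : S m :=
  if eqP is ReflectT e then ecast i (S i) e x else 0.

Fixpoint orbit (n : nat) (x : S n) (m : nat) : S m :=
  if m is p.+1 then place x p.+1 + sys_map (orbit x p) else place x 0.

Lemma place_id n (x : S n) : place x n = x.
Proof. by rewrite /place; case: eqP => // e; rewrite eq_axiomK. Qed.

Lemma place_neq n (x : S n) m : n != m -> place x m = 0.
Proof. by rewrite /place; case: eqP. Qed.

Let sys_map0 m : sys_map (0 : S m) = 0.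
Proof. exact: (cstar_morphism0 (@sys_map_morphism _ S m)). Qed.

Lemma orbit_lt n (x : S n) m : (m < n)%N -> orbit x m = 0.
Proof.
elim: m => [|m IH] mn /=; first by rewrite place_neq// gt_eqF.
by rewrite place_neq ?gt_eqF// IH ?(ltnW mn)// add0r sys_map0.
Qed.

Lemma orbit_id n (x : S n) : orbit x n = x.
Proof.
case: n x => [|n] x /=; first exact: place_id.
by rewrite place_id orbit_lt// sys_map0 addr0.
Qed.

Lemma orbitS n (x : S n) m : (n <= m)%N -> orbit x m.+1 = sys_map (orbit x m).
Proof. by move=> nm /=; rewrite place_neq ?add0r// ltn_eqF. Qed.

Lemma orbit_sys_map n (x : S n) m : (n < m)%N -> orbit (sys_map x) m = orbit x m.
Proof.
elim: m => // m IH; rewrite ltnS leq_eqVlt => /orP[/eqP <-|nm].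
  by rewrite orbit_id orbitS// orbit_id.
by rewrite !orbitS// ?(ltnW nm)// IH.
Qed.

Lemma orbit_morphism n m : cstar_morphism (fun x : S n => orbit x m).
Proof.
have [nm|mn] := leqP n m; last first.
  by rewrite (_ : (fun x => _) = fun=> 0); [exact: cstar_morphism_zero|
    apply/funext => x; exact: orbit_lt].
elim: m nm => [|m IH]; rewrite leq_eqVlt => /orP[/eqP nm|//].
- by subst n; rewrite (_ : (fun x => _) = id); [|apply/funext => x; exact: orbit_id].
- by subst n; rewrite (_ : (fun x => _) = id); [|apply/funext => x; exact: orbit_id].
rewrite ltnS => nm; rewrite (_ : (fun x => _) = fun x : S n => sys_map (orbit x m)).
  exact: cstar_morphism_comp (IH nm) (@sys_map_morphism _ S m).
by apply/funext => x; exact: orbitS.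
Qed.

Lemma orbit_orbit n (x : S n) m l : (n <= m)%N -> (m <= l)%N ->
  orbit (orbit x m) l = orbit x l.
Proof.
move=> nm /subnK <-; elim: (l - m)%N => [|d IH]; first exact: orbit_id.
by rewrite addSn !orbitS ?leq_addl ?(leq_trans nm (leq_addl _ _))// IH.
Qed.

Lemma sys_iter_orbit k d (x : S k) : sys_iter d x = orbit x (d + k).
Proof.
elim: d => [|d IH] /=; first by rewrite [RHS]orbit_id.
by rewrite IH place_neq ?add0r// ltn_eqF// ltnS leq_addl.
Qed.

Lemma connecting_map_orbit k l (kl : (k < l)%N) (x : S k) :
  connecting_map kl x = orbit x l.
Proof.
rewrite /connecting_map sys_iter_orbit.
(* With the source index generalized to a variable, the cast disappears by case analysis on the
   equality. *)
by move: (l - k + k)%N (subnK _) => m e; case: l / e kl.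
Qed.

Lemma cocone_orbit (B : cstarAlgType R) (f : forall k, S k -> B) : cocone f ->
  forall n (x : S n) m, (n <= m)%N -> f m (orbit x m) = f n x.
Proof.
move=> [_ fS] n x m /subnK <-; elim: (m - n)%N => [|d IH]; first by rewrite orbit_id.
by rewrite addSn orbitS ?leq_addl// fS IH.
Qed.

End Orbits.

Section InductiveLimits.
Variables (R : realType) (S : inductive_system R).
Implicit Types A B : cstarAlgType R.
Let Ig n : cstar_ideal (@setT (S n)) := @cstar_idealT R (S n).
Local Notation tails := (null_quotient Ig).

Lemma orbit_bound n (x : S n) m : nrm (orbit x m) <= nrm x.
Proof. exact: (cstar_morphism_contractive (orbit_morphism S n m)). Qed.

Definition orbit_class n (x : S n) : tails :=
  coset_of (cstar_null_ideal Ig) (bounded_seq (orbit_bound x)).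

(** The orbits of x and of its image differ only at index n, hence by a null sequence. *)
Lemma orbit_class_cocone : cocone orbit_class.
Proof.
split=> [n|n x].
  apply: (@cstar_morphism_comp _ _ _ _ (fun x : S n => bounded_seq (orbit_bound x))
    (coset_of _) _ (coset_of_morphism _)).
  by apply: cstar_morphism_bsec => m; exact: orbit_morphism.
apply/coset_ofP/(null_idealP Ig); split=> //.
apply: (@null_seq_le _ _ (fun=> 0) n.+1) => [m nm|]; last exact: cvg_cst.
by rewrite bsecBE /= orbit_sys_map// subrr nrm0 lexx.
Qed.

(** By the universal property the orbit classes factor through 0, and a sequence of class 0 is
    null. *)
Lemma null_orbit : is_inductive_limit S (zero_algebra R) ->
  forall n (x : S n), (fun m => nrm (orbit x m)) @ \oo --> (0 : R).
Proof.
move=> [iota _ univ] n x; have [g [[gm gE] _]] := univ _ _ orbit_class_cocone.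
have : orbit_class x = 0.
  by rewrite -gE (_ : iota n x = 0) ?(cstar_morphism0 gm)//; case: (iota n x).
by move=> /coset_ofP/(null_idealP Ig)[_]; under eq_fun do rewrite subr0.
Qed.

(** The orbit classes induce a morphism on A, whose coordinatewise lifts are the psi n. Convergence
    comes from the uniqueness in the universal property, applied with values in the bounded
    sequences of A modulo null sequences. *)
Lemma inductive_limit_approximation A (iota : forall k, S k -> A) : cocone iota ->
  (forall B (f : forall k, S k -> B), cocone f ->
    exists! g : A -> B, cstar_morphism g /\ (forall k x, g (iota k x) = f k x)) ->
  semiprojective A ->
  exists psi : forall n, A -> S n, (forall n, cstar_morphism (psi n)) /\
    forall a, (fun n => nrm (iota n (psi n a) - a)) @ \oo --> (0 : R).
Proof.
move=> ci univ Asp; have [im iS] := ci.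
have [g [[gm gE] _]] := univ _ _ orbit_class_cocone.
have [k [psi [psim psiE]]] := semiprojective_lift_sequence Asp gm.
exists psi; split=> //.
pose Ag (n : nat) := @cstar_idealT R A.
pose const (a : A) := bounded_seq (B := fun=> A) (fun=> lexx (nrm a)).
have approxb a n : nrm (iota n (psi n a)) <= nrm a.
  rewrite (le_trans (cstar_morphism_contractive (im n) _))//.
  exact: cstar_morphism_contractive.
pose approx (a : A) := bounded_seq (B := fun=> A) (approxb a).
pose cls (h : A -> bsection (product_space (fun _ : nat => A))) (a : A) :
  null_quotient Ag := coset_of (cstar_null_ideal Ag) (h a).
have clsm (h : A -> bsection (product_space (fun _ : nat => A))) :
    (forall n, cstar_morphism (fun a => h a n)) -> cstar_morphism (cls h).
  move=> hm; apply: cstar_morphism_comp (coset_of_morphism (cstar_null_ideal Ag)).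
  exact: cstar_morphism_bsec.
have constm : cstar_morphism (cls const) by apply: clsm => n.
have approxm : cstar_morphism (cls approx).
  apply: clsm => n; exact: (cstar_morphism_comp (psim n) (im n)).
(* The constant sequence of a and the sequence of the iota n (psi n a) define two morphisms that
   both extend this cocone. *)
have ccone : cocone (fun k (x : S k) => cls const (iota k x)).
  split=> [n|n x]; last by rewrite iS.
  exact: (cstar_morphism_comp (im n) constm).
have [h [_ huniq]] := univ _ _ ccone.
have hconst : h = cls const by apply: huniq.
have happrox : h = cls approx.
  apply: huniq; split=> // j x; apply/coset_ofP/(null_idealP Ag); split=> //.
  (* The orbit of x represents the value at iota j x, so psi n (iota j x) is asymptotic to it, and
     iota n maps the orbit to the constant iota j x from index j on. *)
  have [_ px] := psiE (iota j x) _ (esym (gE j x)).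
  apply: (@null_seq_le _ _ _ j) px => n jn.
  rewrite nrm_ge0 !bsecBE /= -(cocone_orbit ci x jn) -(cstar_morphismB (im n)).
  exact: cstar_morphism_contractive.
move=> a; have : cls approx a = cls const a by rewrite -happrox hconst.
move=> /coset_ofP/(null_idealP Ag)[_]; apply: (@null_seq_le _ _ _ 0%N) => n _.
by rewrite nrm_ge0 bsecBE lexx.
Qed.

End InductiveLimits.

(** * Constant systems and the implications of the theorem *)

Section ConstantSystem.
Variables (R : realType) (A : cstarAlgType R).

Definition constant_system : inductive_system R :=
  InductiveSystem (fun _ : nat => @cstar_morphism_id R A).

Lemma constant_system_limit : is_inductive_limit constant_system A.
Proof.
exists (fun _ x => x); first by split=> // k; exact: cstar_morphism_id.
move=> B f [fm fS]; have f0 k x : f k x = f 0%N x.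
  by elim: k x => // k IH x; rewrite -IH; exact: fS.
exists (f 0%N); split=> [|g [_ gE]].
  by split=> [|k x]; [exact: fm|rewrite f0].
by apply/funext => x; rewrite (gE 0%N).
Qed.

Lemma constant_system_iter k d (x : A) : @sys_iter R constant_system k d x = x.
Proof. by elim: d => //= d ->. Qed.

Lemma constant_connecting_map k l (kl : (k < l)%N) (x : A) :
  @connecting_map R constant_system k l kl x = x.
Proof.
rewrite /connecting_map constant_system_iter.
by move: (subnK _); move: (l - k + k)%N => m e; case: l / e kl.
Qed.

End ConstantSystem.

Lemma homotopic_cst (R : realType) (A B : cstarAlgType R) (f : A -> B) :
  cstar_morphism f -> homotopic f f.
Proof.
move=> fm; exists (fun a _ => f a); split=> // a.
by apply: continuous_subspaceT => t; exact: cvg_cst.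
Qed.

Lemma zero_algebra_semiprojective (R : realType) : semiprojective (zero_algebra R).
Proof.
move=> C J Jc Jincr Q Qoo pi piE sigma sm; exists 0%N, (fun=> 0).
  exact: cstar_morphism_zero.
move=> x; have -> : x = 0 by case: x.
rewrite (cstar_morphism0 sm) -[X in pi _ X](cstar_morphism0 (qproj_morphism (Q 0%N))).
by rewrite piE (cstar_morphism0 (qproj_morphism Qoo)).
Qed.

(** The constant systems at A and at 0 are equivalent through zero morphisms: on the side of A the
    required homotopy from 0 to the identity is the reversed contraction. *)
Lemma contractible_trivial_shape (R : realType) (A : cstarAlgType R) :
  semiprojective A -> contractible A -> trivial_shape A.
Proof.
move=> Asp Ac; exists (constant_system A), (constant_system (zero_algebra R)); split.
- by split=> [|k]; [exact: constant_system_limit|exact: Asp].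
- by split=> [|k]; [exact: constant_system_limit|exact: zero_algebra_semiprojective].
(* Even indices for A and odd ones for 0 interlace as required. *)
have kn i : (i.*2 < i.*2.+1)%N by [].
have nk i : (i.*2.+1 < i.+1.*2)%N by rewrite doubleS.
exists (fun i => i.*2), (fun i => i.*2.+1), kn, nk, (fun _ _ => 0), (fun _ _ => 0).
split=> [i|i|i|i]; [exact: cstar_morphism_zero|exact: cstar_morphism_zero| |].
- have -> : @connecting_map R (constant_system A) _ _ (ltn_trans (kn i) (nk i)) =
      fun x => x by apply/funext => x; exact: constant_connecting_map.
  exact: homotopic_sym Ac.
- have -> : @connecting_map R (constant_system (zero_algebra R)) _ _
      (ltn_trans (nk i) (kn i.+1)) = fun=> 0.
    by apply/funext => x; rewrite constant_connecting_map; case: x.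
  by apply: homotopic_cst; exact: cstar_morphism_zero.
Qed.

Lemma trivial_shape_projective (R : realType) (A : cstarAlgType R) :
  semiprojective A -> trivial_shape A -> projective A.
Proof.
move=> Asp [S [T [[[iota ci univ] _] [Tlim _] [k [n [kn [nk [alpha [beta]]]]]]]]].
move=> [am bm ba ab] C J Jc Q sigma sm; have [im _] := ci.
suff [l lm lE] : liftable sigma by exists l.
have [psi [psim psi_cvg]] := inductive_limit_approximation ci univ Asp.
have kincr i : (i <= k i)%N.
  elim: i => // i IH; apply: leq_ltn_trans IH _; exact: ltn_trans (kn i) (nk i).
have nge i : (i <= n i)%N by rewrite (leq_trans (kincr i))// ltnW.
have kk i : (k i <= k i.+1)%N by rewrite ltnW// (ltn_trans (kn i) (nk i)).
have nn i : (n i <= n i.+1)%N by rewrite ltnW// (ltn_trans (nk i) (kn i.+1)).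
(* Along the cofinal indices k i, these morphisms converge pointwise to sigma, so stability applies
   to the constant family sigma. *)
suff lift i : liftable (fun a => sigma (iota (k i) (psi (k i) a))).
  have [//|//|a|_ //] := @liftable_cvg _ A C J Q
    (fun i a => sigma (iota (k i) (psi (k i) a))) (fun=> sigma) Asp Jc.
  apply: (@null_seq_le _ _ (fun i => nrm (iota (k i) (psi (k i) a) - a)) 0%N) => [i _|].
    rewrite nrm_ge0 -(cstar_morphismB sm) (nrm_distrC _ a).
    exact: cstar_morphism_contractive.
  apply/null_seqP => [i|e e0]; first exact: nrm_ge0.
  have /null_seqP/(_ e e0)[|N NP] := psi_cvg a; first by move=> i; exact: nrm_ge0.
  by exists N => i Ni; apply: NP; exact: leq_trans (kincr i).
(* X pushes alpha i (psi a) forward in T to level n (d + i); Y returns from there through S and A to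
   the quotient. *)
pose X d (a : A) := orbit (alpha i (psi (k i) a)) (n (d + i)%N).
pose Y d (a : A) : Q := sigma (iota (k (d + i).+1) (beta (d + i)%N (X d a))).
have nd d : (n i <= n (d + i)%N)%N.
  by elim: d => // d IH; rewrite addSn (leq_trans IH).
have Xm d : cstar_morphism (X d).
  exact: (cstar_morphism_comp (cstar_morphism_comp (psim (k i)) (am i))
    (orbit_morphism T (n i) (n (d + i)%N))).
have Ym d : cstar_morphism (Y d).
  exact: (cstar_morphism_comp (cstar_morphism_comp (Xm d) (bm (d + i)%N))
    (cstar_morphism_comp (im _) sm)).
have X0 a : X 0%N a = alpha i (psi (k i) a) by exact: orbit_id.
have bah d (B : cstarAlgType R) (f : B -> S (k d)) : cstar_morphism f ->
    homotopic (fun x => sigma (iota (k d.+1) (beta d (alpha d (f x)))))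
              (fun x => sigma (iota (k d) (f x))).
  move=> fm; have := homotopic_comp fm (cstar_morphism_comp (im (k d.+1)) sm) (ba d).
  by under [X in homotopic _ X]eq_fun do rewrite connecting_map_orbit (cocone_orbit ci _ (kk d)).
(* Inserting beta o alpha after the beta of Y d changes it only up to homotopy, by [bah]; then alpha
   o beta is homotopic to the connecting map of T, which produces Y d.+1. *)
have step d : liftable (Y d.+1) -> liftable (Y d).
  move=> lY; pose f a := beta (d + i)%N (X d a).
  have fm : cstar_morphism f := cstar_morphism_comp (Xm d) (bm _).
  apply: (homotopic_liftable Asp Jc (bah _ _ f fm)).
  have := homotopic_comp (Xm d)
    (cstar_morphism_comp (bm (d.+1 + i)%N) (cstar_morphism_comp (im _) sm)) (ab (d + i)%N).
  move=> /homotopic_sym h; apply: (homotopic_liftable Asp Jc h).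
  have [l lm lE] := lY; exists l => // a; rewrite lE /Y; congr (sigma (iota _ (beta _ _))).
  by rewrite connecting_map_orbit /X orbit_orbit.
(* The X d a run along an orbit in T, which is null, so the Y d tend pointwise to the zero morphism,
   which lifts. *)
have [d lY] : exists d, liftable (Y d).
  apply: (@liftable_cvg _ A C J Q (fun _ _ => 0) Y) => // [_|a].
    exists (fun=> 0); first exact: cstar_morphism_zero.
    by move=> _; exact: cstar_morphism0 (qproj_morphism Q).
  under eq_fun do rewrite subr0.
  apply: (@null_seq_le _ _ (fun d => nrm (X d a)) 0%N) => [d _|].
    rewrite nrm_ge0 /Y (le_trans (cstar_morphism_contractive sm _))//.
    rewrite (le_trans (cstar_morphism_contractive (im _) _))//.
    exact: cstar_morphism_contractive.
  apply/null_seqP => [d|e e0]; first exact: nrm_ge0.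
  have /null_seqP/(_ e e0)[|N NP] := null_orbit Tlim (alpha i (psi (k i) a)).
    by move=> m; exact: nrm_ge0.
  by exists N => d Nd; apply: NP; rewrite (leq_trans Nd)// (leq_trans _ (nge _))// leq_addr.
have lY0 : liftable (Y 0%N) by elim: d lY => // d IH /step.
(* Y 0 is the target morphism with beta i o alpha i inserted. *)
apply: (homotopic_liftable Asp Jc (bah i _ _ (psim (k i)))).
by have [l lm lE] := lY0; exists l => // a; rewrite lE /Y X0.
Qed.

(** The closed union is again a closed ideal, so sigma lifts all the way to C, and already k = 0
    works. *)
Lemma projective_semiprojective (R : realType) (A : cstarAlgType R) :
  projective A -> semiprojective A.
Proof.
move=> Ap C J Jc Jincr Q Qoo pi piE sigma sm.
have [psi psim psiE] := Ap _ _ (closed_ideal_closure_bigcup Jincr Jc) Qoo sigma sm.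
exists 0%N, (fun a => qproj (Q 0%N) (psi a)).
  exact: (cstar_morphism_comp psim (qproj_morphism _)).
by move=> x; rewrite piE psiE.
Qed.

(** Approximate lifts on growing finite parts of a dense sequence, with tolerance 1/(n+1), converge
    to sigma at every point by contractivity. Stability for the constant family sigma then gives an
    exact lift. *)
Lemma weakly_projective_projective (R : realType) (A : cstarAlgType R) :
  separable_space A -> semiprojective A -> weakly_projective A -> projective A.
Proof.
move=> [D Dc Dd] Asp Aw C J Jc Q sigma sm.
have qm := qproj_morphism Q.
(* D is inhabited, hence enumerated by a surjection s from the natural numbers. *)
have [x0 [_ Dx0]] : setT `&` D !=set0 by apply: Dd; [exists 0|exact: openT].
have /pfcard_geP[D0|[s]] := Dc; first by rewrite D0 in Dx0.
have Fn (n : nat) : finite_set (s @` `I_n) by exact/finite_image/finite_II.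
have /choice[lam lamP] : forall n : nat, exists l : A -> C, cstar_morphism l /\
    forall m, (m < n)%N -> nrm (qproj Q (l (s m)) - sigma (s m)) < n.+1%:R^-1.
  move=> n; have [|l lm lE] := Aw _ _ Jc Q sigma sm (n.+1%:R^-1) _ _ (Fn n).
    by rewrite invr_gt0 ltr0n.
  exists l; split=> // m mn; rewrite -ltcR -nrmE; apply: lE.
  by exists m.
suff cvg0 a : (fun n => nrm (sigma a - qproj Q (lam n a))) @ \oo --> (0 : R).
  have lm n : cstar_morphism (lam n) by have [] := lamP n.
  by have [] := liftable_of_cvg Asp Jc lm (fun=> sm) cvg0.
apply/null_seqP => [n|e e0]; first exact: nrm_ge0.
have Da : closure D a.
  move=> U aU; have [|y [Uy Dy]] := Dd (interior U) _ (@open_interior _ U).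
    by exists a.
  by exists y; split=> //; exact: interior_subset Uy.
have /closure_nrmP/(_ (e / 3))[|y Dy ay] := Da; first by rewrite divr_gt0.
have [m _ my] := @surj _ _ _ _ s y Dy.
have [N HN] : exists N : nat, forall n : nat, (N <= n)%N -> n.+1%:R^-1 < e / 3.
  have /null_seqP/(_ (e / 3))[n||N HN] := @cvg_harmonic R.
  - by rewrite invr_ge0 ler0n.
  - by rewrite divr_gt0.
  - by exists N.
(* From m + 1 on, y = s m is among the controlled points; from N on, the tolerance is below e / 3.
   The other two thirds bound the passages from a to y and back. *)
exists (maxn m.+1 N) => n; rewrite geq_max => /andP[mn Nn].
have [lm /(_ m mn)] := lamP n; rewrite my => ny.
have {}ny := lt_trans ny (HN n Nn).
have s1 := cstar_morphism_contractive sm (a - y).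
have l1 := cstar_morphism_contractive (cstar_morphism_comp lm qm) (y - a).
rewrite (cstar_morphismB sm) in s1; rewrite (cstar_morphismB lm) (cstar_morphismB qm) in l1.
have := nrm_triangle (sigma y) (sigma a) (qproj Q (lam n a)).
have := nrm_triangle (qproj Q (lam n y)) (sigma y) (qproj Q (lam n a)).
rewrite (nrm_distrC (sigma y) (qproj Q (lam n y))).
by rewrite (nrm_distrC y) in l1; lra.
Qed.

Theorem corollary5p7 (R : realType) (A : cstarAlgType R)
    (A_separable : separable_space A) :
  [<-> projective A;
       semiprojective A /\ weakly_projective A;
       semiprojective A /\ contractible A;
       semiprojective A /\ trivial_shape A].
Proof.
tfae=> [Ap|[Asp Aw]|[Asp Ac]|[Asp At]].
- split; first exact: projective_semiprojective.
  move=> C J Jc Q sigma sm e F e0 _; have [psi psim psiE] := Ap _ _ Jc Q sigma sm.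
  by exists psi => // x _; rewrite psiE subrr normr0 ltcR.
(* Contractibility is reached through projectivity. *)
- split=> //; apply: projective_contractible.
  exact: weakly_projective_projective.
- by split=> //; exact: contractible_trivial_shape.
- exact: trivial_shape_projective.
Qed.
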